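(* Every subdivided caterpillar admits an antimagic orientation. That is, if $T$ is a subdivided caterpillar with $m$ edges, then there exist an orientation $D$ of $T$ and a bijection $\tau: A(D)\to\{1,2,\ldots,m\}$ such that $s_{[D,\tau]}(u)\neq s_{[D,\tau]}(v)$ for any two distinct vertices $u,v\in V(D)$.
   Context: All graphs are finite and simple. An orientation $D$ of a graph $G$ is a digraph obtained by assigning exactly one direction to each edge of $G$; $V(D)$ and $A(D)$ denote its vertex set and arc set. For a digraph $D$ with $m\ge 1$ arcs and a bijection $\tau:A(D)\to\{1,\ldots,m\}$, the (oriented) vertex-sum $s_{[D,\tau]}(u)$ of a vertex $u$ is the sum of the labels $\tau(a)$ over all arcs $a$ entering $u$ minus the sum of the labels $\tau(a)$ over all arcs $a$ leaving $u$. The bijection $\tau$ is an antimagic labeling of $D$ if no two distinct vertices of $D$ have the same vertex-sum. A graph $G$ admits an antimagic orientation if some orientation of $G$ has an antimagic labeling. A caterpillar is a tree of order at least 3 such that the removal of its leaves produces a path (a single vertex counts as a path). A longest path $P$ in a caterpillar is fixed and called its spine; every vertex not on $P$ is then a leaf adjacent to an internal vertex of $P$. The legs of the caterpillar are the edges not on $P$ (each is incident with an internal vertex of $P$). Subdividing an edge $r\ge 0$ times means replacing it by a path with $r+1$ edges whose $r$ internal vertices are new. A subdivided caterpillar is a graph obtained from a caterpillar with spine $P$ by subdividing every leg the same number of times $r\ge 0$, and subdividing each edge of $P$ an arbitrary number ($\ge 0$) of times (these numbers may differ from edge to edge of $P$). *)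

(* Defs.v *)
From HB Require Import structures.
From mathcomp Require Import all_boot all_order all_algebra.

Set Implicit Arguments.
Unset Strict Implicit.
Unset Printing Implicit Defensive.

Import GRing.Theory.

Record sgraph := SGraph {
  vert :> finType;
  adj : rel vert;
  adj_sym : symmetric adj;
  adj_irr : irreflexive adj }.

Arguments adj {s}.

Definition edges (G : sgraph) : {set {set G}} :=
  [set [set p.1; p.2] | p : G * G & adj p.1 p.2].

Definition iso (G H : sgraph) : Prop :=
  exists2 f : G -> H, bijective f & forall x y, adj (f x) (f y) = adj x y.

Section Induced.
Variables (G : sgraph) (A : {set G}).
Definition induced_adj : rel {x : G | x \in A} :=
  fun x y => adj (val x) (val y).
Lemma induced_sym : symmetric induced_adj.
Proof. by move=> x y; apply: adj_sym. Qed.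
Lemma induced_irr : irreflexive induced_adj.
Proof. by move=> x; apply: adj_irr. Qed.
Definition induced : sgraph := SGraph induced_sym induced_irr.
End Induced.

(* The path graph with n edges, hence n.+1 vertices. *)
Section PathGraph.
Variable n : nat.
Definition path_adj : rel 'I_n.+1 :=
  fun i j => (i.+1 == j :> nat) || (j.+1 == i :> nat).
Lemma path_adj_sym : symmetric path_adj.
Proof. by move=> i j; rewrite /path_adj orbC. Qed.
Lemma path_adj_irr : irreflexive path_adj.
Proof. by move=> i; rewrite /path_adj orbb gtn_eqF. Qed.
Definition path_graph : sgraph := SGraph path_adj_sym path_adj_irr.
End PathGraph.

Definition is_path_graph (G : sgraph) : Prop := exists n, iso G (path_graph n).

(* A cycle is a [ucycle] of length at least 3: a walk x, y, x along a single
   edge is a [ucycle] of length 2. *)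
Definition is_tree (G : sgraph) : Prop :=
  [/\ 0 < #|G|,
      forall x y : G, connect adj x y
    & forall c : seq G, ucycle adj c -> size c < 3].

Definition leaves (G : sgraph) : {set G} :=
  [set x | #|[set y | adj x y]| == 1].

Definition is_caterpillar (G : sgraph) : Prop :=
  [/\ is_tree G, 3 <= #|G| & is_path_graph (induced (~: leaves G))].

(* A path in a graph, given by the sequence of its vertices. *)
Definition is_path (G : sgraph) (P : seq G) : bool :=
  if P is x :: p then path adj x p && uniq P else false.

Definition is_spine (G : sgraph) (P : seq G) : Prop :=
  is_path P /\ forall Q : seq G, is_path Q -> size Q <= size P.

Definition path_edges (G : sgraph) (P : seq G) : seq {set G} :=
  [seq [set a.1; a.2] | a <- zip P (behead P)].

Definition legs (G : sgraph) (P : seq G) : {set {set G}} :=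
  [set f in edges G | f \notin path_edges P].

(* The subdivision of G in which each edge f is subdivided k f times (values of
   k outside [edges G] are irrelevant).  Every edge is represented once, by the
   pair of its ends in the order of [enum G]; the path replacing (a, b) is
   traversed from a, at position 0, to b, at position (k f).+1. *)
Section Subdivision.
Variables (G : sgraph) (k : {set G} -> nat).

Definition oedge : finType :=
  {p : G * G | adj p.1 p.2 && (enum_rank p.1 < enum_rank p.2)}.

Definition mult (p : oedge) : nat := k [set (val p).1; (val p).2].

Definition sd_vert : finType := (G + {p : oedge & 'I_(mult p)})%type.

Definition at_pos (p : oedge) (i : nat) (x : sd_vert) : bool :=
  match x with
  | inl v => (i == 0) && (v == (val p).1)
             || (i == (mult p).+1) && (v == (val p).2)
  | inr w => (tag w == p) && (i == (tagged w).+1)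
  end.

Definition sd_adj : rel sd_vert := fun x y =>
  [exists p : oedge, exists i : 'I_(mult p).+1,
     at_pos p i x && at_pos p i.+1 y || at_pos p i y && at_pos p i.+1 x].

Lemma sd_adj_sym : symmetric sd_adj.
Proof.
by move=> x y; apply: eq_existsb => p; apply: eq_existsb => i; rewrite orbC.
Qed.

Lemma sd_adj_irr : irreflexive sd_adj.
Proof.
move=> x; apply/negbTE/negP => /existsP[p /existsP[i]]; rewrite orbb.
case: x => [v|w] /=.
  have np : (val p).1 != (val p).2.
    by apply: contraTneq (valP p) => /= ->; rewrite ltnn andbF.
  case/andP=> /orP[] /andP[/eqP ei /eqP ev].
    by case/andP=> _ /eqP ev'; rewrite -ev -ev' eqxx in np.
  by have := ltn_ord i; rewrite ei ltnn.
by case/andP=> /andP[_ /eqP ->] /andP[_]; rewrite gtn_eqF.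
Qed.

Definition subdivide : sgraph := SGraph sd_adj_sym sd_adj_irr.
End Subdivision.

Definition is_subdivided_caterpillar (T : sgraph) : Prop :=
  exists (G : sgraph) (P : seq G) (k : {set G} -> nat) (r : nat),
    [/\ is_caterpillar G,
        is_spine P,
        forall f, f \in legs P -> k f = r
      & iso T (subdivide k)].

Definition is_orientation (G : sgraph) (D : rel G) : Prop :=
  (forall u v, D u v -> adj u v) /\ (forall u v, adj u v -> D u v (+) D v u).

Definition arcs (V : finType) (D : rel V) : {set V * V} :=
  [set a | D a.1 a.2].

(* tau restricts to a bijection from the arcs onto {1, ..., m}; its values
   outside [arcs D] are irrelevant. *)
Definition is_labeling (V : finType) (D : rel V) (tau : V * V -> nat) : Prop :=
  [/\ {in arcs D &, injective tau},
      forall a, a \in arcs D -> 1 <= tau a <= #|arcs D|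
    & forall l, 1 <= l <= #|arcs D| -> exists2 a, a \in arcs D & tau a = l].

Definition vertex_sum (V : finType) (D : rel V) (tau : V * V -> nat) (u : V) :
    int :=
  (\sum_(a in arcs D | a.2 == u) (tau a)%:Z
   - \sum_(a in arcs D | a.1 == u) (tau a)%:Z)%R.

Definition is_antimagic_labeling (V : finType) (D : rel V)
    (tau : V * V -> nat) : Prop :=
  [/\ 0 < #|arcs D|, is_labeling D tau
    & forall u v, u != v -> vertex_sum D tau u != vertex_sum D tau v].

Definition admits_antimagic_orientation (G : sgraph) : Prop :=
  exists (D : rel G) (tau : G * G -> nat),
    is_orientation D /\ is_antimagic_labeling D tau.

(* Main.v *)
(** The tree is a "comb": a path v_0, ..., v_n, with paths of a common length L
    (the legs) hanging at interior vertices of it, the roots.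

    If L >= 2, orient every edge from one colour class to the other.  Up to a
    sign fixed by the class, vertex sums are then sums of incident labels, which
    only have to be distinct within each class.  The smallest labels go to the
    legs, except their edges at the roots, and to at most L - 1 edges at each
    end of the path, up to the first root; they are dealt out in layers, starting
    from the leaves, so that the sums at vertices of degree 2 increase (first in,
    first out).  The
    next labels go to the middle of the path in a zigzag that makes its sums
    s_i consecutive integers.  The largest labels go to the leg edges at the
    roots, which makes the sums at roots exceed all others.  What remains are
    the sums w of the two top labels of a leg: s_i has the parity of i up to a
    constant, and a conflict with w needs i and the root to have opposite
    parities, so w has to be kept off one residue mod 2 that depends on the
    parity of the root.  All w have the same parity if the two top layers are
    labelled in parallel; leaving a gap in one of them flips this parity for the
    legs before the gap, and those are chosen to be the legs at roots of one
    parity.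

    If L = 1, the path vertices without legs are traversed by the orientation
    instead: a zigzag gives them the absolute sums n - 2, ..., 1, and all
    absolute sums become distinct. *)
Require Import Defs.
From mathcomp Require Import all_boot all_order all_algebra.
From mathcomp Require Import zify.

Set Implicit Arguments.
Unset Strict Implicit.
Unset Printing Implicit Defensive.

(** * Antimagic orientations and rooted trees *)

Lemma iso_admits (G H : sgraph) :
  iso G H -> admits_antimagic_orientation H -> admits_antimagic_orientation G.
Proof.
case=> f f_bij f_adj [D [tau [[DA DX] [m_gt0 [tau_inj tau_bd tau_on] sum_neq]]]].
have [g gK fK] := f_bij; have f_inj := bij_inj f_bij.
pose D' : rel G := fun x y => D (f x) (f y).
pose ff (a : G * G) := (f a.1, f a.2).
have ff_inj : injective ff by move=> [a b] [c d] [/f_inj -> /f_inj ->].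
have ff_arc a : (ff a \in arcs D) = (a \in arcs D') by rewrite !inE.
have ff_bij : bijective ff.
  by exists (fun a => (g a.1, g a.2)) => [[a b]|[a b]] /=; rewrite /ff /= ?gK ?fK.
have card_arcs : #|arcs D'| = #|arcs D|.
  rewrite -(card_imset _ ff_inj); apply: eq_card => b.
  have [h _ hK] := ff_bij; apply/imsetP/idP => [[a aD ->]|bD]; first by rewrite ff_arc.
  by exists (h b); rewrite ?hK // -ff_arc hK.
have sumE u : vertex_sum D' (tau \o ff) u = vertex_sum D tau (f u).
  rewrite /vertex_sum; congr (_ - _)%R.
    rewrite [RHS](reindex ff) /=; last exact: onW_bij.
    by apply: eq_bigl => a; rewrite ff_arc (inj_eq f_inj).
  rewrite [RHS](reindex ff) /=; last exact: onW_bij.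
  by apply: eq_bigl => a; rewrite ff_arc (inj_eq f_inj).
exists D', (tau \o ff); split; first split=> u v.
- by move=> /DA; rewrite f_adj.
- by rewrite -f_adj => /DX.
split; [by rewrite card_arcs | split |].
- move=> a b aD bD /tau_inj; rewrite !ff_arc => /(_ aD bD).
  exact: ff_inj.
- by move=> a aD; rewrite card_arcs; apply: tau_bd; rewrite ff_arc.
- move=> l; rewrite card_arcs => /tau_on[b bD <-].
  by have [h _ hK] := ff_bij; exists (h b); rewrite /= ?hK // -ff_arc hK.
- by move=> u v uv; rewrite !sumE; apply: sum_neq; rewrite (inj_eq f_inj).
Qed.

Section Parent.
Import GRing.Theory.
Local Open Scope ring_scope.

Variables (T : sgraph) (par : T -> option T).
Hypothesis adj_par : forall u v : T, adj u v = (par u == Some v) || (par v == Some u).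
Hypothesis par_asym : forall u v : T, par u = Some v -> par v != Some u.
Variables (lam : T -> nat) (up : pred T).
Let m := #|[set u | par u]|.
Hypothesis m_gt0 : (0 < m)%N.
Hypothesis lam_inj : forall u v, par u -> par v -> lam u = lam v -> u = v.
Hypothesis lam_bd : forall u, par u -> (0 < lam u <= m)%N.

(* The edge from [u] to its parent is labelled [lam u] and leaves [u] iff [up u]. *)
Definition signed_label (u : T) : int := if up u then - (lam u)%:Z else (lam u)%:Z.

(** An edge contributes opposite amounts at its two ends, hence the minus sign in front of the
    children. *)
Definition signed_sum (u : T) : int :=
  (if par u then signed_label u else 0)
  - \sum_(c | par c == Some u) signed_label c.

(** Each edge is represented by its child end. Labels that are distinct and lie between 1 and the
    number [m] of edges are onto by counting. *)
Lemma parent_admits :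
  injective signed_sum -> admits_antimagic_orientation T.
Proof.
move=> sum_inj.
pose D : rel T := fun u v =>
  (par u == Some v) && up u || (par v == Some u) && ~~ up v.
pose tau (a : T * T) := if par a.1 == Some a.2 then lam a.1 else lam a.2.
pose arc (u : T) : T * T :=
  if par u is Some v then (if up u then (u, v) else (v, u)) else (u, u).
have arcP a : reflect (exists2 u, par u & a = arc u) (a \in arcs D).
  rewrite inE; apply: (iffP orP) => [[]/andP[/eqP e upu]|[u pu ->]].
  - by exists a.1; rewrite /arc e ?upu //; case: (a).
  - by exists a.2; rewrite /arc e ?(negbTE upu) //; case: (a).
  - rewrite /arc; case e: (par u) pu => [v|//] _.
    by case upu: (up u); rewrite /= e upu eqxx; [left | right].
have tau_arc u : par u -> tau (arc u) = lam u.
  rewrite /tau /arc; case e: (par u) => [v|//] _.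
  by case: (up u); rewrite /= ?e ?eqxx // (negbTE (par_asym e)).
have arc_inj : {in [set u | par u] &, injective arc}.
  by move=> u v; rewrite !inE => pu pv /(congr1 tau); rewrite !tau_arc //; apply: lam_inj.
have arcsE : arcs D = arc @: [set u | par u].
  by apply/setP=> a; apply/arcP/imsetP => -[u pu ->]; exists u; rewrite // inE in pu *.
have card_arcs : #|arcs D| = m by rewrite arcsE card_in_imset.
exists D, tau; split; first split=> u v.
- by rewrite adj_par => /orP[]/andP[-> _]; rewrite ?orbT.
- rewrite adj_par /D => /orP[] /eqP e.
    by rewrite e eqxx (negbTE (par_asym e)) /= orbF; case: (up u).
  by rewrite e eqxx (negbTE (par_asym e)) /= orbF; case: (up v).
split; first by rewrite card_arcs.
- split.
  + move=> a b /arcP[u pu ->] /arcP[v pv ->]; rewrite !tau_arc // => /(lam_inj pu pv).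
    by move=> ->.
  + by move=> a /arcP[u pu ->]; rewrite tau_arc // card_arcs lam_bd.
  + move=> l; rewrite card_arcs => /andP[l_gt0 l_le].
    have lt1 (u : T) : ((lam u).-1 %% m.+1 < m.+1)%N by rewrite ltn_mod.
    pose h u : 'I_m.+1 := inord (lam u).
    have h_val u : par u -> h u = lam u :> nat.
      by move=> pu; rewrite inordK // ltnS; case/andP: (lam_bd pu).
    have hi : {in [set u | par u] &, injective h}.
      move=> u v; rewrite !inE => pu pv /(congr1 val) /=.
      by rewrite !h_val //; apply: lam_inj.
    (* [h] takes [m] distinct values, none of them 0, in a set with [m] nonzero elements; so every
       nonzero value occurs. *)
    have hS : h @: [set u | par u] \subset [set~ ord0].
      apply/subsetP=> x /imsetP[u]; rewrite inE => pu ->.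
      rewrite !inE -val_eqE /= h_val //.
      by case/andP: (lam_bd pu); case: (lam u).
    have : inord l \in h @: [set u | par u].
      have /eqP -> : h @: [set u | par u] == [set~ ord0].
        by rewrite eqEcard hS card_in_imset // cardsC1 card_ord /= leqnn.
      by rewrite !inE -val_eqE /= inordK ?ltnS // -lt0n.
    case/imsetP=> u; rewrite inE => pu /(congr1 val) /=.
    rewrite h_val // inordK ?ltnS // => e.
    by exists (arc u); [apply/arcP; exists u | rewrite tau_arc].
- suff sumE u : vertex_sum D tau u = signed_sum u.
    by move=> u v; apply: contra_neq; rewrite !sumE; apply: sum_inj.
  rewrite /vertex_sum arcsE.
  rewrite !big_mkcondr /= !big_imset //= -sumrB.
  (* The arc of [v] is met twice: at [v] with its signed label, and at the parent of [v] with the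
     opposite sign. *)
  have term v : (if v \in [set u | par u] then
      (if (arc v).2 == u then (tau (arc v))%:Z else 0) -
      (if (arc v).1 == u then (tau (arc v))%:Z else 0) else 0)
    = (if v == u then if par v then signed_label v else 0 else 0)
      - (if par v == Some u then signed_label v else 0).
    rewrite inE; case e: (par v) => [w|] /=; last by rewrite if_same subr0.
    rewrite tau_arc ?e // /arc e /signed_label (inj_eq Some_inj).
    have wv : (w == v) = false.
      by apply/eqP=> wv; have := adj_irr v; rewrite adj_par e wv eqxx.
    have [vu|vu] := eqVneq v u.
      by rewrite -vu wv; case: (up v); rewrite /= wv eqxx ?subr0 ?sub0r.
    by case: (up v); rewrite /= (negbTE vu); case: (w == u);
       rewrite ?opprK ?subr0 ?sub0r ?oppr0 ?add0r.
  rewrite big_mkcond (eq_bigr _ (fun v _ => term v)) sumrB /signed_sum.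
  by rewrite -!big_mkcond big_pred1_eq.
Qed.

End Parent.

(** * Combs *)

Section Comb.
Variables (n L : nat) (R : seq nat).

(* [inl i] is the spine vertex v_i, and [inr (c, l)] the vertex at distance [l]
   from the leaf of the leg [c], which hangs at the spine vertex [nth 0 R c].
   The comb is rooted at [inl 0], and [v] is the parent of [u]. *)
Definition comb_up (u v : nat + nat * nat) : bool :=
  match u, v with
  | inl i, inl j => i == j.+1
  | inr (c, l), inl j => (l.+1 == L) && (nth 0 R c == j)
  | inr (c, l), inr (c', l') => (c == c') && (l.+1 == l')
  | inl _, inr _ => false
  end.

Definition comb_vert : finType := ('I_n.+1 + 'I_(size R) * 'I_L)%type.

Definition comb_code (u : comb_vert) : nat + nat * nat :=
  match u with
  | inl i => inl (nat_of_ord i)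
  | inr (c, l) => inr (nat_of_ord c, nat_of_ord l)
  end.

Definition comb_adj : rel comb_vert := fun u v =>
  comb_up (comb_code u) (comb_code v) || comb_up (comb_code v) (comb_code u).

Lemma comb_sym : symmetric comb_adj.
Proof. by move=> u v; rewrite /comb_adj orbC. Qed.

Lemma comb_irr : irreflexive comb_adj.
Proof.
by move=> u; rewrite /comb_adj orbb; case: u => [i|[c l]] /=; rewrite ?eqxx;
  apply/negbTE; lia.
Qed.

Definition comb : sgraph := SGraph comb_sym comb_irr.

Lemma comb_code_inj : injective comb_code.
Proof.
move=> [i|[c l]] [j|[d k]] //= => [[/val_inj ->//]|].
by move=> [/val_inj -> /val_inj ->].
Qed.

Lemma comb_up_fun (u v w : comb) :
  comb_up (comb_code u) (comb_code v) -> comb_up (comb_code u) (comb_code w) ->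
  v = w.
Proof.
move=> uv uw; apply: comb_code_inj.
case: u v w uv uw => [i|[c l]] [j|[d k]] [j'|[d' k']] //=; try lia.
- by move=> ij ij'; congr inl; lia.
- by move=> /andP[_ /eqP ->] /andP[_ /eqP ->].
- have := ltn_ord k'; lia.
- have := ltn_ord k; lia.
- by move=> /andP[/eqP <- /eqP <-] /andP[/eqP <- /eqP <-].
Qed.

Definition comb_par (u : comb) : option comb :=
  [pick v | comb_up (comb_code u) (comb_code v)].

Lemma comb_parE (u v : comb) :
  (comb_par u == Some v) = comb_up (comb_code u) (comb_code v).
Proof.
rewrite /comb_par; case: pickP => [w uw|no]; last by rewrite no.
by apply/eqP/idP => [[<-//]|uv]; congr Some; apply: comb_up_fun uw uv.
Qed.

Lemma comb_adj_par (u v : comb) :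
  adj u v = (comb_par u == Some v) || (comb_par v == Some u).
Proof. by rewrite !comb_parE. Qed.

Lemma comb_par_asym (u v : comb) :
  comb_par u = Some v -> comb_par v != Some u.
Proof.
move=> /eqP; rewrite comb_parE => uv; rewrite comb_parE.
by case: u v uv => [i|[c l]] [j|[d k]] //=; lia.
Qed.

Hypothesis L_gt0 : 0 < L.
Hypothesis n_gt0 : 0 < n.
Hypothesis R_bd : all (fun r => r <= n) R.

Lemma nth_root c : c < size R -> nth 0 R c <= n.
Proof. by move=> cR; apply: (allP R_bd); rewrite mem_nth. Qed.

Lemma comb_par_some (u : comb) :
  comb_par u = (if u is inl i then 0 < i else true) :> bool.
Proof.
rewrite /comb_par; case: pickP => [w|no] /=.
  by case: u w => [i|[c l]] [j|[d k]] //=; lia.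
case: u no => [i|[c l]] no.
  case: (posnP i) => // i_gt0; have iP : i.-1 < n.+1 by have := ltn_ord i; lia.
  by have := no (inl (Ordinal iP)); rewrite /= prednK ?eqxx.
have [lL|lL] := eqVneq l.+1 L.
  have rP : nth 0 R c < n.+1 by rewrite ltnS nth_root.
  by have := no (inl (Ordinal rP)); rewrite /= lL !eqxx.
have lP : l.+1 < L by have := ltn_ord l; lia.
by have := no (inr (c, Ordinal lP)); rewrite /= !eqxx.
Qed.

Lemma card_comb_par : #|[set u | comb_par u]| = n + size R * L.
Proof.
have card_comb : #|comb| = n.+1 + size R * L by rewrite card_sum card_prod !card_ord.
have -> : [set u | comb_par u] = [set~ (inl ord0 : comb)].
  apply/setP=> u; rewrite !inE comb_par_some.
  by case: u => [i|[c l]]; rewrite ?(inj_eq (@inl_inj _ _)) -?val_eqE /= -?lt0n.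
by rewrite cardsC1 card_comb addSn.
Qed.

Import GRing.Theory.
Local Open Scope ring_scope.

Variables (e : nat -> nat) (lab : nat -> nat -> nat).
Let m := (n + size R * L)%N.
Hypothesis e_bd : forall i, (0 < i <= n)%N -> (0 < e i <= m)%N.
Hypothesis lab_bd :
  forall c l, (c < size R)%N -> (l < L)%N -> (0 < lab c l <= m)%N.
Hypothesis e_inj : forall i j,
  (0 < i <= n)%N -> (0 < j <= n)%N -> e i = e j -> i = j.
Hypothesis lab_inj : forall c l d k,
  (c < size R)%N -> (l < L)%N -> (d < size R)%N -> (k < L)%N ->
  lab c l = lab d k -> c = d /\ l = k.
Hypothesis e_lab : forall i c l,
  (0 < i <= n)%N -> (c < size R)%N -> (l < L)%N -> e i <> lab c l.

Let comb_lab (u : comb) : nat :=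
  match u with inl i => e i | inr (c, l) => lab c l end.

Lemma comb_lab_inj (u v : comb) :
  comb_par u -> comb_par v -> comb_lab u = comb_lab v -> u = v.
Proof.
rewrite !comb_par_some.
case: u v => [i|[c l]] [j|[d k]] //= pu pv eq_lab.
- by congr inl; apply/val_inj/e_inj; rewrite ?pu ?pv // -ltnS ltn_ord.
- by case: (@e_lab i d k); rewrite // pu -ltnS ltn_ord.
- by case: (@e_lab j c l); rewrite // pv -ltnS ltn_ord.
- have [] := lab_inj _ _ _ _ eq_lab => //.
  by move=> /val_inj -> /val_inj ->.
Qed.

Lemma comb_lab_bd (u : comb) :
  comb_par u -> (0 < comb_lab u <= #|[set u | comb_par u]|)%N.
Proof.
rewrite comb_par_some card_comb_par; case: u => [i|[c l]] /= pu.
  by apply: e_bd; rewrite pu -ltnS ltn_ord.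
exact: lab_bd.
Qed.

(* [e i] is the label of the edge between v_(i-1) and v_i, and [lab c l] that of
   the edge above the vertex [l] of the leg [c]. *)
Definition dir (b : bool) (x : nat) : int := if b then - x%:Z else x%:Z.

Variables (es : nat -> bool) (ls : nat -> nat -> bool).

Definition spine_val i : int :=
  (if (0 < i)%N then dir (es i) (e i) else 0)
  - (if (i < n)%N then dir (es i.+1) (e i.+1) else 0)
  - \sum_(c < size R | nth 0%N R c == i) dir (ls c L.-1) (lab c L.-1).

Definition leg_val c l : int :=
  dir (ls c l) (lab c l) - (if (0 < l)%N then dir (ls c l.-1) (lab c l.-1) else 0).

Let comb_sgn (u : comb) : bool :=
  match u with inl i => es i | inr (c, l) => ls c l end.

Lemma comb_signed_sum (u : comb) :
  signed_sum comb_par comb_lab comb_sgn u =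
    match u with inl i => spine_val i | inr (c, l) => leg_val c l end.
Proof.
rewrite /signed_sum (eq_bigl _ _ (fun c => comb_parE c u)) big_sumType /=.
rewrite comb_par_some /signed_label.
case: u => [i|[c l]] /=.
  rewrite opprD addrA; congr (_ - _ - _).
    have [ni|ni] := ltnP i n.
      rewrite (big_pred1 (Ordinal (ni : i.+1 < n.+1)%N)) //.
    by rewrite big_pred0 // => j; have := ltn_ord j; lia.
  rewrite (eq_bigl (fun u : 'I_(size R) * 'I_L =>
      (nth 0%N R u.1 == i) && (u.2.+1 == L))%N); last first.
    by case=> d k /=; rewrite andbC.
  rewrite (eq_bigr (fun u : 'I_(size R) * 'I_L => dir (ls u.1 u.2) (lab u.1 u.2)));
    last by case=> d k.
  rewrite -(pair_big (fun d : 'I_(size R) => nth 0%N R d == i)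
     (fun k : 'I_L => k.+1 == L)
     (fun (d : 'I_(size R)) (k : 'I_L) => dir (ls d k) (lab d k))) /=.
  apply: eq_bigr => d _.
  have lP : (L.-1 < L)%N by lia.
  rewrite (big_pred1 (Ordinal lP)) // => k.
  by apply/eqP/eqP => [e1|->] /=; [apply: val_inj => /=; lia | lia].
rewrite big_pred0 // add0r /leg_val; congr (_ - _).
have [->|l_gt0] := posnP l.
  by rewrite big_pred0 // => -[d k] /=; rewrite andbF.
have lP : (l.-1 < L)%N by have := ltn_ord l; lia.
rewrite (big_pred1 (c, Ordinal lP)) // => -[d k].
apply/idP/eqP => [/andP[/eqP e1 /eqP e2]|[-> ->]] /=; last by lia.
by congr (_, _); apply: val_inj => /=; lia.
Qed.

Lemma comb_admits :
  (forall i j, (i <= n)%N -> (j <= n)%N -> spine_val i = spine_val j -> i = j) ->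
  (forall c l d k, (c < size R)%N -> (l < L)%N -> (d < size R)%N -> (k < L)%N ->
     leg_val c l = leg_val d k -> c = d /\ l = k) ->
  (forall i c l, (i <= n)%N -> (c < size R)%N -> (l < L)%N ->
     spine_val i <> leg_val c l) ->
  admits_antimagic_orientation comb.
Proof.
move=> sp_inj leg_inj sp_leg.
apply: (parent_admits comb_adj_par comb_par_asym _ comb_lab_inj comb_lab_bd
  (up := comb_sgn)); first by rewrite card_comb_par; lia.
move=> u v; rewrite !comb_signed_sum.
case: u v => [i|[c l]] [j|[d k]] eq_val.
- by congr inl; apply/val_inj/sp_inj; rewrite // -ltnS ltn_ord.
- by case: (@sp_leg i d k); rewrite // -ltnS ltn_ord.
- by case: (@sp_leg j c l); rewrite // -ltnS ltn_ord.
- have [] := leg_inj _ _ _ _ _ _ _ _ eq_val => //.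
  by move=> /val_inj -> /val_inj ->.
Qed.

End Comb.

(** * Combs oriented from one colour class to the other *)

Section Bipartite.
Variables (n L : nat) (R : seq nat) (e : nat -> nat) (lab : nat -> nat -> nat).

Definition spine_sum i : nat :=
  (if 0 < i then e i else 0) + (if i < n then e i.+1 else 0)
  + \sum_(c < size R | nth 0 R c == i) lab c L.-1.

Definition leg_sum c l : nat := lab c l + (if 0 < l then lab c l.-1 else 0).

(** The colour class: this vertex is at distance [L - l] from the root of its leg, whose own class
    is the parity of its index. *)
Definition leg_class c l : bool := odd (nth 0 R c + L - l).

End Bipartite.

Lemma dir_eq b c x y : 0 < x -> 0 < y -> dir b x = dir c y -> b = c /\ x = y.
Proof. rewrite /dir; case: b c => -[] x0 y0 xy; split=> //; lia. Qed.

(** Edges go from odd to even vertices, so all edges at a vertex contribute with the sign of its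
    class. The unsigned sums are positive; hence vertices of different classes never clash, and only
    equal classes appear in the last three conditions. *)
Lemma comb_bipartite_admits n L R e lab (m := n + size R * L) :
  0 < L -> 0 < n -> all (fun r => r <= n) R ->
  (forall i, 0 < i <= n -> 0 < e i <= m) ->
  (forall c l, c < size R -> l < L -> 0 < lab c l <= m) ->
  (forall i j, 0 < i <= n -> 0 < j <= n -> e i = e j -> i = j) ->
  (forall c l d k, c < size R -> l < L -> d < size R -> k < L ->
     lab c l = lab d k -> c = d /\ l = k) ->
  (forall i c l, 0 < i <= n -> c < size R -> l < L -> e i <> lab c l) ->
  (forall i j, i <= n -> j <= n -> odd i = odd j ->
     spine_sum n L R e lab i = spine_sum n L R e lab j -> i = j) ->
  (forall c l d k, c < size R -> l < L -> d < size R -> k < L ->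
     leg_class L R c l = leg_class L R d k ->
     leg_sum lab c l = leg_sum lab d k -> c = d /\ l = k) ->
  (forall i c l, i <= n -> c < size R -> l < L -> odd i = leg_class L R c l ->
     spine_sum n L R e lab i <> leg_sum lab c l) ->
  admits_antimagic_orientation (comb n L R).
Proof.
move=> L0 n0 Rbd ebd lbd einj linj elab sp_inj leg_inj sp_leg.
have spE i : i <= n ->
    spine_val n L R e lab odd (leg_class L R) i = dir (odd i) (spine_sum n L R e lab i).
  move=> i_le; rewrite /spine_val /spine_sum.
  have -> : (\sum_(c < size R | nth 0 R c == i) dir (leg_class L R c L.-1) (lab c L.-1)
     = dir (~~ odd i) (\sum_(c < size R | nth 0 R c == i) lab c L.-1))%R.
    rewrite (eq_bigr (fun c : 'I_(size R) => dir (~~ odd i) (lab c L.-1))); last first.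
      move=> c /eqP ci; congr dir; rewrite /leg_class ci.
      by have -> : i + L - L.-1 = i.+1 by lia.
    rewrite (big_morph (dir (~~ odd i)) (id1 := 0%R) (op1 := +%R)) //.
    - by move=> x y; rewrite /dir; case: (~~ _) => /=; lia.
    - by rewrite /dir; case: (~~ _).
  set s := \sum_(_ < _ | _) _.
  by rewrite /dir /=; case: (odd i); case: (0 < i); case: (i < n) => /=; lia.
have legE c l : c < size R -> l < L ->
    leg_val lab (leg_class L R) c l = dir (leg_class L R c l) (leg_sum lab c l).
  move=> cR lL; rewrite /leg_val /leg_sum.
  case: (posnP l) => [->|l0]; first by rewrite /= addn0 GRing.subr0.
  have -> : leg_class L R c l.-1 = ~~ leg_class L R c l by rewrite /leg_class; lia.
  by rewrite /dir; case: (leg_class _ _ _ _) => /=; lia.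
have sp_gt0 i : i <= n -> 0 < spine_sum n L R e lab i.
  move=> i_le; rewrite /spine_sum; have [i0|i0] := posnP i.
    by have := ebd 1; rewrite i0 n0 /=; lia.
  by have := ebd i; lia.
have leg_gt0 c l : c < size R -> l < L -> 0 < leg_sum lab c l.
  by move=> cR lL; have := lbd c l cR lL; rewrite /leg_sum; lia.
apply: (comb_admits L0 n0 Rbd ebd lbd einj linj elab
  (es := odd) (ls := leg_class L R)).
- move=> i j i_le j_le; rewrite !spE // => /dir_eq[]; rewrite ?sp_gt0 //.
  exact: sp_inj.
- move=> c l d k cR lL dR kL; rewrite !legE // => /dir_eq[]; rewrite ?leg_gt0 //.
  exact: leg_inj.
- move=> i c l i_le cR lL; rewrite spE // legE // => /dir_eq[]; rewrite ?sp_gt0 ?leg_gt0 //.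
  exact: sp_leg.
Qed.

(** * Isomorphisms onto combs and between combs *)

Definition in_comb n L (R : seq nat) (u : nat + nat * nat) : bool :=
  match u with inl i => i <= n | inr (c, l) => (c < size R) && (l < L) end.

Lemma comb_codeP n L R u :
  reflect (exists v : comb n L R, comb_code v = u) (in_comb n L R u).
Proof.
apply: (iffP idP) => [|[v <-]].
  case: u => [i i_le|[c l] /andP[cR lL]].
    by exists (inl (Ordinal (i_le : i < n.+1))).
  by exists (inr (Ordinal cR, Ordinal lL)).
by case: v => [i|[c l]] /=; [rewrite -ltnS ltn_ord | rewrite !ltn_ord].
Qed.

(** Allows isomorphisms to be given by coordinates in plain natural numbers; the map into the
    ordinals of the comb and its inverse are chosen from the codes. *)
Lemma iso_comb (G : sgraph) n L R (coord : G -> nat + nat * nat) :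
  injective coord ->
  (forall x, in_comb n L R (coord x)) ->
  (forall u, in_comb n L R u -> exists x, coord x = u) ->
  (forall x y, adj x y =
     comb_up L R (coord x) (coord y) || comb_up L R (coord y) (coord x)) ->
  iso G (comb n L R).
Proof.
move=> coord_inj coord_in coord_on adjE.
have fP x : exists v : comb n L R, comb_code v == coord x.
  by have /comb_codeP[v e] := coord_in x; exists v; apply/eqP.
have gP (v : comb n L R) : exists x, coord x == comb_code v.
  by have [|x e] := coord_on (comb_code v); [apply/comb_codeP; exists v | exists x; apply/eqP].
pose f x := xchoose (fP x); pose g v := xchoose (gP v).
have fE x : comb_code (f x) = coord x by apply/eqP; exact: (xchooseP (fP x)).
have gE v : coord (g v) = comb_code v by apply/eqP; exact: (xchooseP (gP v)).
exists f; first exists g => [x|v].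
- by apply: coord_inj; rewrite gE fE.
- by apply: comb_code_inj; rewrite fE gE.
- by move=> x y; rewrite adjE -!fE.
Qed.

Lemma iso_trans (G H K : sgraph) : iso G H -> iso H K -> iso G K.
Proof.
case=> f f_bij fE [g g_bij gE]; exists (g \o f); first exact: bij_comp.
by move=> x y; rewrite /= gE fE.
Qed.

(** Reading the spine from its other end exchanges the two arms, so that asymmetric constructions
    may assume the convenient side. *)
Lemma comb_rev_iso n L R : all (fun r => r <= n) R ->
  iso (comb n L R) (comb n L [seq n - r | r <- R]).
Proof.
move=> /allP R_bd; pose coord (u : comb n L R) : nat + nat * nat :=
  match u with inl i => inl (n - i) | inr (c, l) => inr (c : nat, l : nat) end.
have rb c : c < size R -> nth 0 R c <= n by move=> cR; apply: R_bd; apply: mem_nth.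
apply: (@iso_comb _ n L _ coord) => [u v|u|u|u v].
- case: u v => [i|[c l]] [j|[d k]] //= => [[ij]|[cd lk]].
    by congr inl; apply: val_inj => /=; have := ltn_ord i; have := ltn_ord j; lia.
  by congr inr; congr pair; apply: val_inj.
- by case: u => [i|[c l]] /=; [lia | rewrite size_map !ltn_ord].
- case: u => [i|[c l]] /= => [i_le|].
    have iP : n - i < n.+1 by lia.
    by exists (inl (Ordinal iP)); rewrite /= subKn.
  rewrite size_map => /andP[cR lL].
  by exists (inr (Ordinal cR, Ordinal lL)).
- case: u v => [i|[c l]] [j|[d k]]; rewrite /= /comb_adj /=.
  + by have := ltn_ord i; have := ltn_ord j; lia.
  + rewrite (nth_map 0) //; have := rb _ (ltn_ord d); have := ltn_ord i; lia.
  + rewrite (nth_map 0) //; have := rb _ (ltn_ord c); have := ltn_ord j; lia.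
  + by [].
Qed.

(** The numbering of the legs is free, so it can be adapted to the labels. *)
Lemma comb_perm_iso n L R R' : perm_eq R R' -> iso (comb n L R) (comb n L R').
Proof.
move=> RR'; have sz := perm_size RR'.
have [Is IsP RE] : exists2 Is : seq nat,
    perm_eq Is (iota 0 (size R')) & R = [seq nth 0 R' i | i <- Is].
  by have /(perm_iotaP 0)[Is] := RR'; exists Is.
have szI : size Is = size R by rewrite (perm_size IsP) size_iota sz.
have uI : uniq Is by rewrite (perm_uniq IsP) iota_uniq.
have mI c : (c \in Is) = (c < size R') by rewrite (perm_mem IsP) mem_iota.
pose coord (u : comb n L R) : nat + nat * nat :=
  match u with inl i => inl (i : nat) | inr (c, l) => inr (nth 0 Is c, l : nat) end.
have nR c : c < size R -> nth 0 R c = nth 0 R' (nth 0 Is c).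
  by move=> cR; rewrite {1}RE (nth_map 0) // szI.
apply: (@iso_comb _ n L _ coord) => [u v|u|u|u v].
- case: u v => [i|[c l]] [j|[d k]] //= => [[/val_inj-> //]|[cd /val_inj->]].
  congr inr; congr pair; apply/val_inj/eqP => /=.
  by rewrite -(nth_uniq 0 _ _ uI) ?szI ?ltn_ord ?cd.
- case: u => [i|[c l]] /=; first by rewrite -ltnS ltn_ord.
  by rewrite -mI mem_nth ?szI // ltn_ord.
- case: u => [i|[c l]] /= => [i_le|/andP[cR lL]].
    by exists (inl (Ordinal (i_le : i < n.+1))).
  have cP : index c Is < size R by rewrite -szI index_mem mI.
  by exists (inr (Ordinal cP, Ordinal lL)); rewrite /= nth_index ?mI.
- case: u v => [i|[c l]] [j|[d k]]; rewrite /= /comb_adj //= ?nR //.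
  by rewrite !(nth_uniq 0) ?szI.
Qed.

(* For a single leg, the spine and the leg can be exchanged: the left arm, of
   length [a], becomes the leg. *)
Lemma comb_reroot_iso n L a : a < L -> n - a < L -> a <= n - a ->
  iso (comb n L [:: a]) (comb (L + (n - a)) a [:: L]).
Proof.
move=> aL naL a_le.
(* Read from its leaf, the old leg fills the first [L] spine positions, which puts the root at [L];
   the right arm follows it. *)
pose coord (u : comb n L [:: a]) : nat + nat * nat :=
  match u with
  | inl i => if i < a then inr (0, i : nat) else inl (L + (i - a))
  | inr (c, l) => inl (l : nat)
  end.
apply: (@iso_comb _ (L + (n - a)) a _ coord) => [u v|u|u|u v].
- case: u v => [i|[c l]] [j|[d k]]; rewrite /coord.
  + case: ifP => ia; case: ifP => ja // [ij]; congr inl; apply: val_inj => /=; lia.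
  + by case: ifP => // ia [] /= e; have := ltn_ord k; lia.
  + by case: ifP => // ja [] /= e; have := ltn_ord l; lia.
  + by move=> [/val_inj ->]; rewrite (ord1 c) (ord1 d).
- case: u => [i|[c l]] /=; last by have := ltn_ord l; lia.
  by have := ltn_ord i; case: ifP => /= ia; lia.
- case: u => [i|[c l]] /= => [i_le|/andP[c0 la]].
    have [iL|Li] := ltnP i L; first by exists (inr (ord0, Ordinal iL)).
    have iP : i - L + a < n.+1 by lia.
    exists (inl (Ordinal iP)) => /=; rewrite ifF; first by congr inl; lia.
    lia.
  have lP : l < n.+1 by lia.
  by exists (inl (Ordinal lP)); rewrite /= la; congr inr; congr pair; lia.
- case: u v => [i|[c l]] [j|[d k]]; rewrite /= /comb_adj.
  + by case: ifP => ia; case: ifP => ja /=; lia.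
  + by rewrite (ord1 d); case: ifP => ia /=; have := ltn_ord k; lia.
  + by rewrite (ord1 c); case: ifP => ja /=; have := ltn_ord l; lia.
  + by rewrite (ord1 c) (ord1 d) /=; lia.
Qed.

(** * The spine of a caterpillar *)

Section Caterpillar.
Variable G : sgraph.
Hypothesis G_tree : is_tree G.
Hypothesis G_card : 3 <= #|G|.

Let N (x : G) : {set G} := [set y | adj x y].

Lemma tree_neighbor (x : G) : exists y, adj x y.
Proof.
have [_ conn _] := G_tree.
have [y xy] : exists y, y != x.
  apply/existsP; apply: contraTT G_card; rewrite negb_exists => /forallP all_x.
  rewrite -ltnNge ltnS (leq_trans _ (isT : 1 <= 2)) //; apply/card_le1_eqP => u v _ _.
  by have /negPn/eqP-> := all_x u; have /negPn/eqP-> := all_x v.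
have /connectP[[|z p] /= pP yE] := conn x y; first by rewrite yE eqxx in xy.
by exists z; case/andP: pP.
Qed.

Lemma leaf_neighbor (x y z : G) : x \in leaves G -> adj x y -> adj x z -> y = z.
Proof.
rewrite inE => /cards1P[w Nw] xy xz.
have : y \in N x by rewrite inE.
have : z \in N x by rewrite inE.
by rewrite /N Nw !inE => /eqP-> /eqP->.
Qed.

Lemma nonleaf_neighbor (x y : G) :
  x \notin leaves G -> exists2 z, adj x z & z != y.
Proof.
have [w xw] := tree_neighbor x; rewrite inE => N1.
have [|none] := pickP [pred z | adj x z & z != y].
  by move=> z /andP[xz zy]; exists z.
case/negP: N1; apply/cards1P; exists w; apply/setP=> z; rewrite !inE.
have oneE u : adj x u -> u = y.
  by move=> xu; have := none u; rewrite /= xu => /negbFE/eqP.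
apply/idP/eqP => [/oneE->|->//]; by rewrite (oneE _ xw).
Qed.

(** Two adjacent leaves would form a connected component of order 2. *)
Lemma leaf_leaf (x y : G) : x \in leaves G -> y \in leaves G -> ~~ adj x y.
Proof.
move=> xL yL; apply/negP => xy; have [_ conn _] := G_tree.
have yx : adj y x by rewrite adj_sym.
have cl : closed adj [set x; y].
  move=> u v uv; rewrite !inE; apply/idP/idP => /orP[]/eqP e; move: uv; rewrite e.
  - by move=> /(leaf_neighbor xL xy) ->; rewrite eqxx orbT.
  - by move=> /(leaf_neighbor yL yx) ->; rewrite eqxx.
  - by rewrite adj_sym => /(leaf_neighbor xL xy) ->; rewrite eqxx orbT.
  - by rewrite adj_sym => /(leaf_neighbor yL yx) ->; rewrite eqxx.
have sub : [set: G] \subset [set x; y].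
  by apply/subsetP=> z _; rewrite -(closed_connect cl (conn x z)) !inE eqxx.
move: (subset_leq_card sub); rewrite cardsT cards2 => le.
by move: (leq_trans G_card le); case: (x != y).
Qed.

(** A chord would close the segment of the path between its ends to a cycle of length at least 3. *)
Lemma tree_no_chord (x0 : G) (P : seq G) i j : is_path P ->
  i < size P -> j < size P -> adj (nth x0 P i) (nth x0 P j) ->
  (i.+1 == j) || (j.+1 == i).
Proof.
wlog ij : i j / i <= j.
  move=> H pP iP jP; have [ij|/ltnW ji] := leqP i j; first exact: H.
  by rewrite adj_sym orbC; apply: H.
move=> pP iP jP a_ij; have [_ _ cyc] := G_tree.
have ne_ij : i != j by apply: contraTneq a_ij => ->; rewrite adj_irr.
rewrite orbC; apply/orP; right; apply: contraTT a_ij => ij1; apply/negP => a_ij.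
have sortedP : sorted adj P /\ uniq P.
  by case: (P) pP => // x p /andP[].
have [sP uP] := sortedP.
pose c := take (j - i).+1 (drop i P).
have szc : size c = (j - i).+1 by rewrite size_take size_drop; case: ifP; lia.
have nthc t : t <= j - i -> nth x0 c t = nth x0 P (i + t).
  by move=> t_le; rewrite nth_take ?ltnS // nth_drop.
have sc : sorted adj c by apply/take_sorted/drop_sorted.
have uc : uniq c by apply/take_uniq/drop_uniq.
have ucyc : ucycle adj c.
  rewrite /ucycle uc andbT.
  have c0 : nth x0 c 0 = nth x0 P i by rewrite nthc // addn0.
  have cl : nth x0 c (size c).-1 = nth x0 P j by rewrite szc nthc //=; congr nth; lia.
  move: c0 cl sc; rewrite nth_last; case: (c) szc => [|u p] //= _ -> cl pathp.
  by rewrite rcons_path pathp cl adj_sym.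
by have := cyc c ucyc; rewrite szc; lia.
Qed.

Variable P : seq G.
Hypothesis P_spine : is_spine P.
Hypothesis G_path : is_path_graph (induced (~: leaves G)).

(* Adding a leaf at each end of the path of all non-leaves gives a path, so [P]
   is at least as long; its interior vertices, being non-leaves, then exhaust the
   non-leaves, and a vertex off [P] is a leaf hanging at one of them. *)
Lemma caterpillar_spine (x0 : G) :
  3 <= size P /\ forall y, y \notin P -> exists i,
    [/\ 0 < i, i.+1 < size P, adj y (nth x0 P i)
      & forall z, adj y z -> z = nth x0 P i].
Proof.
have [n0 [f [g gK fK] fE]] := G_path.
have [pP maxP] := P_spine.
pose u i : G := val (g (inord i)).
have u_nl i : u i \notin leaves G by have := valP (g (inord i)); rewrite inE.
have u_on x : x \notin leaves G -> exists2 i, i <= n0 & x = u i.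
  move=> xL; have xL' : x \in ~: leaves G by rewrite inE.
  exists (f (exist _ x xL')); first by rewrite -ltnS ltn_ord.
  by rewrite /u inord_val gK.
have u_adj i j : i <= n0 -> j <= n0 -> adj (u i) (u j) = (i.+1 == j) || (j.+1 == i).
  move=> i_le j_le; rewrite -[LHS]/(adj (g (inord i)) (g (inord j))) -fE !fK /=.
  by rewrite /path_adj !inordK.
have u_inj i j : i <= n0 -> j <= n0 -> u i = u j -> i = j.
  move=> i_le j_le /val_inj /(can_inj fK) /(congr1 val) /=.
  by rewrite !inordK.
(* A neighbour of the first non-leaf other than the second one must be a leaf. If [n0 = 0], then
   [inord 1] defaults to 0, and the condition is just that [x] differs from [u 0]. *)
have [x xu0 x_ne] := nonleaf_neighbor (u 1) (u_nl 0).
have xL : x \in leaves G.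
  apply: contraNT x_ne => /u_on[i i_le xE]; move: xu0; rewrite xE u_adj //= orbF.
  by move=> /eqP <-.
(* If there is only one non-leaf, a second neighbour of it is taken; otherwise [y] differs from [x]
   because the only neighbour of the leaf [x] is [u 0]. *)
have [y [yun y_x yL]] : exists y, [/\ adj (u n0) y, y != x & y \in leaves G].
  have [n00|n0_gt0] := posnP n0.
    have [y yun y_x] := nonleaf_neighbor x (u_nl n0); exists y; split=> //.
    apply: contraTT yun => /u_on[i i_le ->]; rewrite u_adj //; lia.
  have [y yun y_ne] := nonleaf_neighbor (u n0.-1) (u_nl n0).
  have yL : y \in leaves G.
    apply: contraNT y_ne => /u_on[i i_le yE]; move: yun; rewrite yE u_adj // => ni.
    by apply/eqP; congr u; lia.
  exists y; split=> //; apply: contraTneq yun => ->; rewrite adj_sym; apply/negP => xn.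
  have x_u0 : adj x (u 0) by rewrite adj_sym.
  by have /u_inj := leaf_neighbor xL xn x_u0; lia.
have [U [szU nthU U_nl uU]] : exists U : seq G,
    [/\ size U = n0.+1, forall i, i <= n0 -> nth x0 U i = u i,
        forall z, z \in leaves G -> z \notin U & uniq U].
  exists (mkseq u n0.+1); split; first by rewrite size_mkseq.
  - by move=> i i_le; rewrite nth_mkseq.
  - by move=> z zL; apply/negP => /mapP[i _ zE]; have := u_nl i; rewrite -zE zL.
  - rewrite map_inj_in_uniq ?iota_uniq // => i j.
    by rewrite !mem_iota add0n !ltnS; apply: u_inj.
pose Q := x :: rcons U y.
have szQ : size Q = n0.+3 by rewrite /= size_rcons szU.
have uQ : uniq Q.
  rewrite /= rcons_uniq mem_rcons inE negb_or (eq_sym x) y_x /=.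
  by rewrite !U_nl.
have pQ : is_path Q.
  rewrite /is_path /Q -/Q uQ andbT rcons_path; apply/andP; split; last first.
    by rewrite (last_nth x0) szU /= nthU.
  apply/(pathP x0) => i; rewrite szU ltnS => i_le; rewrite nthU //.
  case: i i_le => [|i] i_le /=; first by rewrite adj_sym.
  by rewrite nthU ?u_adj ?eqxx // ltnW.
have szP : n0.+3 <= size P by rewrite -szQ maxP.
split; first by clear -szP; lia.
have [sP uP] : sorted adj P /\ uniq P by case: (P) pP => // z p /andP[].
have P_adj i : i.+1 < size P -> adj (nth x0 P i) (nth x0 P i.+1).
  by move=> iP; have /(sortedP x0) := sP; apply.
pose I := [seq nth x0 P i | i <- iota 1 (size P).-2].
have I_bd i : i \in iota 1 (size P).-2 -> 0 < i /\ i.+1 < size P.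
  by rewrite mem_iota; clear; lia.
have I_nl : {subset I <= ~: leaves G}.
  move=> z /mapP[i /I_bd[i0 i1] zE]; rewrite inE; apply/negP => zL.
  have i2 : i.-1.+1 = i by rewrite prednK.
  have i3 : i.-1 < size P by clear -i1; lia.
  have a1 : adj z (nth x0 P i.+1) by rewrite zE; apply: P_adj.
  have a2 : adj z (nth x0 P i.-1).
    by rewrite zE adj_sym -{2}i2; apply: P_adj; rewrite i2 ltnW.
  have /eqP := leaf_neighbor zL a1 a2; rewrite nth_uniq // -{1}i2.
  by clear; lia.
have uI : uniq I.
  rewrite map_inj_in_uniq ?iota_uniq // => i j /I_bd[_ iP] /I_bd[_ jP] /eqP.
  by rewrite nth_uniq ?(ltnW iP) ?(ltnW jP) // => /eqP.
have card_nl : #|~: leaves G| = n0.+1.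
  have -> : #|~: leaves G| = #|induced (~: leaves G)| by rewrite card_sig; apply: eq_card.
  by rewrite (bij_eq_card (f := f)) ?card_ord //; exists g.
have [_ I_all] : size I = size (enum (~: leaves G)) /\ I =i enum (~: leaves G).
  have sub : {subset I <= enum (~: leaves G)} by move=> z /I_nl; rewrite mem_enum.
  have [] := uniq_min_size uI sub; last by [].
  by rewrite -cardE card_nl size_map size_iota; clear -szP; lia.
have nl_I z : z \notin leaves G -> exists2 i, 0 < i & i.+1 < size P /\ z = nth x0 P i.
  move=> zL; have : z \in I by rewrite I_all mem_enum inE.
  by case/mapP=> i /I_bd[i0 iP] zE; exists i.
move=> z zP.
have zL : z \in leaves G.
  apply: contraNT zP => /nl_I[i _ [iP ->]]; exact: mem_nth (ltnW iP).
have [w zw] := tree_neighbor z.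
have wL : w \notin leaves G by apply: contraTN zw; apply: leaf_leaf.
have [i i0 [iP wE]] := nl_I w wL; exists i; split=> //; first by rewrite -wE.
by move=> v zv; rewrite -wE; apply: leaf_neighbor zv zw.
Qed.

End Caterpillar.

(** * Subdivided caterpillars are combs *)

Lemma mem_zip (S1 S2 : eqType) (s : seq S1) (t : seq S2) a b :
  (a, b) \in zip s t -> a \in s /\ b \in t.
Proof.
elim: s t => [|x s IH] [|y t] //=; rewrite !inE xpair_eqE.
by case/orP=> [/andP[-> ->]|/IH[-> ->]]; rewrite ?orbT.
Qed.

Section CoordinatesOfVertices.
Variables (G : sgraph) (P : seq G) (k : {set G} -> nat) (r : nat) (x0 : G).
Hypothesis G_cat : is_caterpillar G.
Hypothesis P_spine : is_spine P.
Hypothesis k_legs : forall f, f \in legs P -> k f = r.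

(** After subdivision [p i] is at position [off i] of the spine of the comb. The vertices in [Y],
    off [P], are the leaf ends of the legs, and [rt y] is the index on [P] of the neighbour of
    [y]. *)
Let p i := nth x0 P i.
Let kk i := k [set p i; p i.+1].
Let off i := \sum_(j < i) (kk j).+1.
Let Y := [seq y <- enum G | y \notin P].
Let rt y := find (adj y) P.
Let R := [seq off (rt y) | y <- Y].
Let q := (size P).-1.

Let szP : 3 <= size P.
Proof.
have [G_tree G_card G_path] := G_cat.
by case: (caterpillar_spine G_tree G_card P_spine G_path x0).
Qed.

Let uP : uniq P.
Proof. by have [+ _] := P_spine; case: (P) => // z s /andP[]. Qed.

Let p_adj i : i.+1 < size P -> adj (p i) (p i.+1).
Proof.
move=> iP; have sP : sorted adj P by have [+ _] := P_spine; case: (P) => // z s /andP[].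
by have /(sortedP x0) := sP; apply.
Qed.

Let rtP y : y \notin P ->
  [/\ 0 < rt y, (rt y).+1 < size P, adj y (p (rt y)) & forall z, adj y z -> z = p (rt y)].
Proof.
have [G_tree G_card G_path] := G_cat.
have [_ /(_ y) outP] := caterpillar_spine G_tree G_card P_spine G_path x0.
move=> /outP[i [i0 iP yi y_only]].
suff -> : rt y = i by split.
have hasy : has (adj y) P by apply/hasP; exists (p i); rewrite ?mem_nth // ltnW.
have := nth_find x0 hasy; rewrite -/(rt y) => /y_only /eqP.
by rewrite nth_uniq // ?(ltnW iP) -?has_find // => /eqP.
Qed.

Let k_leg y : y \notin P -> k [set y; p (rt y)] = r.
Proof.
move=> yP; have [_ _ yr _] := rtP yP; apply: k_legs; rewrite inE; apply/andP; split.
  by apply/imsetP; exists (y, p (rt y)); rewrite ?inE.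
apply: contra yP => /mapP[[a b] ab /setP/(_ y)]; rewrite !inE eqxx /=.
have := mem_zip ab => -[aP bP].
by move/esym/orP => [/eqP->//|/eqP->]; apply: mem_behead.
Qed.

Let offS i : off i.+1 = off i + (kk i).+1.
Proof. by rewrite /off big_ord_recr. Qed.

Let off_lt i j : i < j -> off i < off j.
Proof.
elim: j => // j IH; rewrite ltnS leq_eqVlt => /predU1P[->|/IH lt_ij]; rewrite offS; lia.
Qed.

Let off_le i j : i <= j -> off i <= off j.
Proof. by rewrite leq_eqVlt => /predU1P[->//|/off_lt/ltnW]. Qed.

(** The intervals from [off i] to [off i + kk i] are disjoint, since the next one starts right
    after. *)
Let off_inj i j s t : s <= kk i -> t <= kk j -> off i + s = off j + t -> i = j /\ s = t.
Proof.
move=> s_le t_le e; have [ij|ji|ij] := ltngtP i j; last by rewrite ij in e *; lia.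
  by have := off_le ij; rewrite offS; lia.
by have := off_le ji; rewrite offS; lia.
Qed.

Let off_split t : t < off q -> exists i, [/\ i < q, off i <= t & t < off i.+1].
Proof.
elim: q => [|j IH]; first by rewrite /off big_ord0.
have [tj _|jt tj] := ltnP t (off j); last by exists j.
by have [i [ij ? ?]] := IH tj; exists i; split=> //; apply: ltnW.
Qed.

(* Edges are traversed upwards on legs and in the direction of [P] on the spine;
   [src a b] means that [a] comes before [b], and [cpos a b i] is the comb
   coordinate of the [i]-th vertex of the path replacing this edge. *)
Let src a b := adj a b && ((a \notin P) || (b \in P) && (index a P < index b P)).

(** An edge with both ends on [P] joins consecutive vertices, as a path in a tree has no chord; any
    other edge is a leg, which starts at its leaf. *)
Let srcP a b : src a b ->
  (a \notin P /\ b = p (rt a) /\ k [set a; b] = r) \/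
  (exists i, [/\ i < q, a = p i, b = p i.+1 & k [set a; b] = kk i]).
Proof.
case/andP=> ab; have [aP|aP /=] := boolP (a \in P); last first.
  by left; have [_ _ _ /(_ b ab)] := rtP aP => bE; split=> //; split=> //; rewrite bE k_leg.
move=> /andP[bP lt_ab]; right; have [G_tree G_card _] := G_cat; have [pP _] := P_spine.
have iaP : index a P < size P by rewrite index_mem.
have ibP : index b P < size P by rewrite index_mem.
have := @tree_no_chord _ G_tree G_card x0 _ _ _ pP iaP ibP.
rewrite !nth_index // => /(_ ab) ch.
have ibE : index b P = (index a P).+1 by lia.
have iq : index a P < q by rewrite /q; lia.
have aE : p (index a P) = a by apply: nth_index.
have bE : p (index a P).+1 = b by rewrite -ibE; apply: nth_index.
by exists (index a P); rewrite /kk aE bE.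
Qed.

Let src_total a b : adj a b -> src a b || src b a.
Proof.
move=> ab; have ba : adj b a by rewrite adj_sym.
rewrite /src ab ba.
have [aP|aP] := boolP (a \in P); have [bP|bP] := boolP (b \in P); rewrite ?orbT //=.
have : index a P != index b P; last by lia.
apply: contraTneq ab => /(congr1 (nth x0 P)); rewrite !nth_index // => ->.
by rewrite adj_irr.
Qed.

Let index_p i : i < size P -> index (p i) P = i.
Proof. by move=> iP; apply: index_uniq. Qed.

Let p_in i : i < size P -> p i \in P.
Proof. exact: mem_nth. Qed.

Let src_spine i : i < q -> src (p i) (p i.+1).
Proof.
by move=> iq; rewrite /src p_adj ?p_in ?index_p ?orbT //=; rewrite /q in iq; lia.
Qed.

Let src_leg y : y \notin P -> src y (p (rt y)).
Proof. by move=> yP; have [_ _ yr _] := rtP yP; rewrite /src yr yP. Qed.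

Let cpos a b i : nat + nat * nat :=
  if a \in P then inl (off (index a P) + i)
  else if i <= r then inr (index a Y, i) else inl (off (index b P)).

Let cspine i s : i < q -> cpos (p i) (p i.+1) s = inl (off i + s).
Proof. by move=> iq; rewrite /cpos p_in ?index_p //; rewrite /q in iq; lia. Qed.

Let coord (x : subdivide k) : nat + nat * nat :=
  match x with
  | inl v => if v \in P then inl (off (index v P)) else inr (index v Y, 0)
  | inr w =>
    let: (a, b) := val (tag w) in
    if src a b then cpos a b (tagged w).+1 else cpos b a (mult k (tag w) - tagged w)
  end.

Let coordP v : v \in P -> coord (inl v) = inl (off (index v P)).
Proof. by rewrite /coord => ->. Qed.

Let coordY v : v \notin P -> coord (inl v) = inr (index v Y, 0).
Proof. by rewrite /coord => /negbTE->. Qed.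

Let cposY y b i : y \notin P -> i <= r -> cpos y b i = inr (index y Y, i).
Proof. by rewrite /cpos => /negbTE-> ->. Qed.

Let cpos0 a b : src a b -> cpos a b 0 = coord (inl a).
Proof.
move=> _; have [aP|aP] := boolP (a \in P); last by rewrite cposY ?coordY.
by rewrite coordP // /cpos aP addn0.
Qed.

Let cposE a b : src a b -> cpos a b (k [set a; b]).+1 = coord (inl b).
Proof.
case/srcP=> [[aP [bE ->]]|[i [iq -> -> ->]]].
  have [_ rP _ _] := rtP aP; have bP : b \in P by rewrite bE p_in // ltnW.
  by rewrite coordP // /cpos (negbTE aP) ltnn.
have iP : i.+1 < size P by move: iq; rewrite /q; lia.
by rewrite cspine // coordP ?p_in // index_p // offS.
Qed.

Let kC (a b : G) : k [set a; b] = k [set b; a].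
Proof. by rewrite setUC. Qed.

(** The subdivision stores an edge in the order of [enum_rank], which is unrelated to [src]; if the
    two directions disagree, positions are counted from the other end. *)
Let coord_at (e : oedge G) i x : at_pos e i x ->
  coord x = if src (val e).1 (val e).2 then cpos (val e).1 (val e).2 i
            else cpos (val e).2 (val e).1 ((mult k e).+1 - i).
Proof.
have /andP[e_adj _] := valP e.
have sym := src_total e_adj.
case: x => [v|w].
  rewrite /at_pos => /orP[]/andP[/eqP-> /eqP->]; case: ifP sym => [ab _|_ ba].
  - by rewrite cpos0.
  - by rewrite subn0 /mult kC cposE.
  - by rewrite /mult cposE.
  - by rewrite subnn cpos0.
case/andP=> /eqP <- /eqP ->; rewrite /coord subSS.
by case: (val (tag w)).
Qed.

Let at_exists (e : oedge G) i : i <= (mult k e).+1 -> exists x : subdivide k, at_pos e i x.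
Proof.
case: i => [_|i]; first by exists (inl (val e).1); rewrite /= !eqxx.
rewrite ltnS leq_eqVlt => /predU1P[->|iP]; first by exists (inl (val e).2); rewrite /= !eqxx.
exists (inr (Tagged (fun e => 'I_(mult k e)) (Ordinal iP))).
by rewrite /= !eqxx.
Qed.

Let oedge_of a b : adj a b -> exists e : oedge G, val e = (a, b) \/ val e = (b, a).
Proof.
move=> ab; have ne : enum_rank a != enum_rank b.
  by apply: contraTneq ab => /enum_rank_inj ->; rewrite adj_irr.
have [lt_ab|lt_ba|/val_inj e] := ltngtP (enum_rank a) (enum_rank b).
- have eP : adj (a, b).1 (a, b).2 && (enum_rank (a, b).1 < enum_rank (a, b).2).
    by rewrite /= ab.
  by exists (exist _ (a, b) eP); left.
- have eP : adj (b, a).1 (b, a).2 && (enum_rank (b, a).1 < enum_rank (b, a).2).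
    by rewrite /= adj_sym ab.
  by exists (exist _ (b, a) eP); right.
- by rewrite e eqxx in ne.
Qed.

Let src_asym a b : src a b -> src b a = false.
Proof.
rewrite /src => /andP[ab]; rewrite adj_sym ab /=.
have [aP|aP] := boolP (a \in P); last first.
  move=> _; have [_ rP _ /(_ b ab) ->] := rtP aP.
  by rewrite p_in ?(ltnW rP).
by move=> /= /andP[-> lt]; apply/negbTE; rewrite /= -leqNgt ltnW.
Qed.

Let walk a b i : src a b -> i <= k [set a; b] -> exists x y : subdivide k,
  [/\ adj x y, coord x = cpos a b i & coord y = cpos a b i.+1].
Proof.
move=> ab i_le; have ab_adj : adj a b by case/andP: ab.
have [e [eE|eE]] := oedge_of ab_adj.
  have multE : mult k e = k [set a; b] by rewrite /mult eE.
  have [x xP] : exists x : subdivide k, at_pos e i x by apply: at_exists; lia.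
  have [y yP] : exists y : subdivide k, at_pos e i.+1 y by apply: at_exists; lia.
  have iP : i < (mult k e).+1 by lia.
  exists x, y; rewrite (coord_at xP) (coord_at yP) eE /= ab; split=> //.
  apply/existsP; exists e; apply/existsP; exists (Ordinal iP).
  by rewrite xP yP.
have multE : mult k e = k [set a; b] by rewrite /mult eE kC.
have [x xP] : exists x : subdivide k, at_pos e ((mult k e - i).+1) x by apply: at_exists; lia.
have [y yP] : exists y : subdivide k, at_pos e (mult k e - i) y by apply: at_exists; lia.
have iP : mult k e - i < (mult k e).+1 by lia.
exists x, y; rewrite (coord_at xP) (coord_at yP) eE /= src_asym // multE; split=> //.
- apply/existsP; exists e; apply/existsP; exists (Ordinal iP).
  by rewrite xP yP orbT.
- by congr cpos; lia.
- by congr cpos; lia.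
Qed.

Let inY y : y \notin P -> y \in Y.
Proof. by move=> yP; rewrite mem_filter yP mem_enum. Qed.

Let index_Y y z : y \notin P -> z \notin P -> index y Y = index z Y -> y = z.
Proof. by move=> yP zP /(congr1 (nth x0 Y)); rewrite !nth_index ?inY. Qed.

(** The bounds on [i] and [i'] leave out the far end of each edge, which other edges may share. *)
Let cpos_inj a b i a' b' i' : src a b -> src a' b' ->
  i <= k [set a; b] -> i' <= k [set a'; b'] ->
  cpos a b i = cpos a' b' i' -> [/\ a = a', b = b' & i = i'].
Proof.
case/srcP=> [[aP [-> ->]]|[j [jq -> -> ->]]];
  case/srcP=> [[aP' [-> ->]]|[j' [jq' -> -> ->]]] i_le i_le'; rewrite ?cspine //.
- by rewrite !cposY // => -[/index_Y-> // ->].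
- by rewrite cposY.
- by rewrite [RHS]cposY.
- by move=> [/off_inj[] // -> ->].
Qed.

Let coord_inr (w : {e : oedge G & 'I_(mult k e)}) :
  exists a b i, [/\ src a b, 0 < i <= k [set a; b], coord (inr w) = cpos a b i
    & ((a, b) = val (tag w) /\ i = (tagged w).+1) \/
      ((b, a) = val (tag w) /\ i = mult k (tag w) - tagged w)].
Proof.
have /andP[e_adj _] := valP (tag w).
have w_lt := ltn_ord (tagged w).
have -> : coord (inr w) = if src (val (tag w)).1 (val (tag w)).2
    then cpos (val (tag w)).1 (val (tag w)).2 (tagged w).+1
    else cpos (val (tag w)).2 (val (tag w)).1 (mult k (tag w) - tagged w).
  by rewrite /coord; case: (val (tag w)).
have [a [b eE]] : exists a b, val (tag w) = (a, b) by case: (val (tag w)) => a b; exists a, b.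
have multE : mult k (tag w) = k [set a; b] by rewrite /mult eE.
rewrite eE /= in e_adj *.
case: ifP (src_total e_adj) => [ab _|_ /= ba].
  by exists a, b, (tagged w).+1; split=> //; [lia | left].
by exists b, a, (mult k (tag w) - tagged w); split=> //; [rewrite kC; lia | right].
Qed.

Let coord_inl_inr v w : coord (inl v) <> coord (inr w).
Proof.
have [a [b [i [ab i_bd -> _]]]] := coord_inr w.
case/srcP: (ab) i_bd => [[aP [-> ->]]|[j [jq -> -> ->]]] i_bd.
  case/andP: i_bd => i0 ir; rewrite cposY //=; case: ifP => // _ [_]; lia.
rewrite cspine //; have [vP|vP] := boolP (v \in P); last by rewrite coordY.
rewrite coordP // => -[e].
have [_] : index v P = j /\ 0 = i by apply: off_inj; lia.
lia.
Qed.

Let coord_inj : injective coord.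
Proof.
move=> [v|w] [v'|w'] e.
- move: e => /=; case: ifP => vP; case: ifP => vP' //.
    move=> [e]; congr inl; have [] := @off_inj (index v P) (index v' P) 0 0.
    + by [].
    + by [].
    + lia.
    by move=> /(congr1 (nth x0 P)); rewrite !nth_index.
  by move=> [/index_Y->] //; rewrite ?vP ?vP'.
- by case: (coord_inl_inr e).
- by case: (coord_inl_inr (esym e)).
move: e; have [a [b [i [ab i_bd -> wE]]]] := coord_inr w.
have [a' [b' [i' [ab' i_bd' -> wE']]]] := coord_inr w'.
have [_ i_le] := andP i_bd; have [_ i_le'] := andP i_bd'.
move=> /(cpos_inj ab ab' i_le i_le')[aE bE iE].
move: aE bE iE wE wE' => <- <- <- wE wE'; congr inr.
(* Both stored pairs consist of [a] and [b] in increasing rank, so they are the same edge. *)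
have /andP[_ lt1] := valP (tag w); have /andP[_ lt2] := valP (tag w').
have tagE : tag w = tag w'.
  apply: val_inj; move: lt1 lt2.
  by case: wE => -[<- _]; case: wE' => -[<- _] //= lt1 lt2; lia.
case: w w' tagE wE wE' {lt1 lt2} => e j [e' j'] /= tagE; rewrite -tagE in j' *.
move=> wE wE'; congr existT; apply: val_inj => /=; have := ltn_ord j; have := ltn_ord j'.
have ne : a <> b by move=> E; move: ab; rewrite /src E adj_irr.
move: wE wE' => /= -[][E1 Ei] [][E2 Ei']; try by [clear -Ei Ei'; lia].
- by case: ne; move: E2; rewrite -E1 => -[].
- by case: ne; move: E2; rewrite -E1 => -[].
Qed.

Let n := off q.

Let cpos_in a b i : src a b -> i <= (k [set a; b]).+1 -> in_comb n r.+1 R (cpos a b i).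
Proof.
case/srcP=> [[aP [-> ->]]|[j [jq -> -> ->]]] i_le.
  rewrite /cpos ifN //; case: ifP => ir /=; first by rewrite size_map index_mem inY.
  have [_ rP _ _] := rtP aP; rewrite index_p ?(ltnW rP) //.
  by apply: off_le; rewrite /q; lia.
rewrite cspine //=; have := @off_le j.+1 q jq; rewrite offS /n; lia.
Qed.

Let coord_in x : in_comb n r.+1 R (coord x).
Proof.
case: x => [v|w]; last first.
  by have [a [b [i [ab i_bd -> _]]]] := coord_inr w; apply: cpos_in => //; lia.
have [vP|vP] := boolP (v \in P); last by rewrite coordY //= size_map index_mem inY.
rewrite coordP //=.
have iP : index v P < size P by rewrite index_mem.
by apply: off_le; rewrite /q; lia.
Qed.

Let nthR c : c < size Y -> nth 0 R c = off (rt (nth x0 Y c)).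
Proof. by move=> cY; rewrite (nth_map x0). Qed.

Let nthY c : c < size Y -> nth x0 Y c \notin P.
Proof. by move=> /(mem_nth x0); rewrite mem_filter => /andP[]. Qed.

Let uY : uniq Y. Proof. by rewrite filter_uniq ?enum_uniq. Qed.

Let leg_walk c l : c < size Y -> l <= r -> exists x y : subdivide k,
  [/\ adj x y, coord x = inr (c, l)
    & coord y = if l < r then inr (c, l.+1) else inl (nth 0 R c)].
Proof.
move=> cY lr; have yP := nthY cY; have [_ rP _ _] := rtP yP.
have [|x [y [xy xE yE]]] := @walk _ _ l (src_leg yP); first by rewrite k_leg.
exists x, y; split=> //; rewrite ?xE ?yE /cpos ifN // ?lr index_uniq //.
by rewrite nthR // index_p // ltnW.
Qed.

Let spine_walk t : t < n -> exists x y : subdivide k,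
  [/\ adj x y, coord x = inl t & coord y = inl t.+1].
Proof.
move=> /off_split[i [iq it ti]].
have [|x [y [xy xE yE]]] := @walk _ _ (t - off i) (src_spine iq).
  by rewrite -/(kk i); rewrite offS in ti; lia.
by exists x, y; split; rewrite // ?xE ?yE cspine //; congr inl; lia.
Qed.

Let coord_on u : in_comb n r.+1 R u -> exists x, coord x = u.
Proof.
case: u => [t /= t_le|[c l] /=].
  have [tn|] := ltnP t n; first by have [x [_ [_ <- _]]] := spine_walk tn; exists x.
  move=> nt; have qP : q < size P by rewrite /q; lia.
  by exists (inl (p q)); rewrite /= p_in ?index_p //; congr inl; rewrite -/n; lia.
rewrite size_map => /andP[cY lr].
by have [x [_ [_ <- _]]] := leg_walk cY lr; exists x.
Qed.

(** Walking along the edges of [G] meets every pair of neighbouring coordinates at adjacent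
    vertices; by injectivity these vertices are [x] and [y]. *)
Let coord_up x y : comb_up r.+1 R (coord x) (coord y) -> adj x y.
Proof.
have := coord_in x; have := coord_in y.
case xE: (coord x) => [i|[c l]]; case yE: (coord y) => [j|[d l']].
- move=> /= jn i_n /eqP iE; have jn' : j < n by rewrite -iE.
  have [x' [y' [xy' xE' yE']]] := spine_walk jn'.
  have -> : x = y' by apply: coord_inj; rewrite xE yE' iE.
  have -> : y = x' by apply: coord_inj; rewrite yE xE'.
  by rewrite sd_adj_sym.
- by [].
- move=> _ /= /andP[cR lr] /andP[/eqP lE /eqP jE].
  have cY : c < size Y by rewrite size_map in cR.
  have [x' [y' [xy' xE' yE']]] := leg_walk cY (lr : l <= r).
  have -> : x = x' by apply: coord_inj; rewrite xE xE'.
  suff -> : y = y' by [].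
  by apply: coord_inj; rewrite yE yE' ifF ?jE //; clear -lE; lia.
- move=> /= /andP[dR lr'] /andP[cR lr] /andP[/eqP cd /eqP ll].
  have cY : c < size Y by rewrite size_map in cR.
  have [x' [y' [xy' xE' yE']]] := leg_walk cY (lr : l <= r).
  have -> : x = x' by apply: coord_inj; rewrite xE xE'.
  suff -> : y = y' by [].
  by apply: coord_inj; rewrite yE yE' ifT ?cd ?ll //; clear -lr' ll; lia.
Qed.

Let cpos_up a b i : src a b -> i <= k [set a; b] ->
  comb_up r.+1 R (cpos a b i) (cpos a b i.+1) || comb_up r.+1 R (cpos a b i.+1) (cpos a b i).
Proof.
case/srcP=> [[aP [-> ->]]|[j [jq -> -> ->]]] i_le.
  have [_ rP _ _] := rtP aP.
  have aY : index a Y < size Y by rewrite index_mem inY.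
  rewrite (cposY _ aP i_le); have [ir|ir] := ltnP i r.
    by rewrite (cposY _ aP ir) /comb_up !eqxx.
  have -> : cpos a (p (rt a)) i.+1 = inl (off (rt a)).
    by rewrite /cpos (negbTE aP) ifN -?ltnNge // index_p // ltnW.
  rewrite /comb_up nthR // nth_index ?inY // eqxx andbT.
  by apply/orP; left; clear -i_le ir; lia.
by rewrite !cspine //= addnS eqxx orbT.
Qed.

Let coord_adj x y : adj x y ->
  comb_up r.+1 R (coord x) (coord y) || comb_up r.+1 R (coord y) (coord x).
Proof.
suff dirE e (i : 'I_(mult k e).+1) u v : at_pos e i u -> at_pos e i.+1 v ->
    comb_up r.+1 R (coord u) (coord v) || comb_up r.+1 R (coord v) (coord u).
  move=> /existsP[e /existsP[i]] /orP[]/andP[h1 h2]; first exact: dirE h1 h2.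
  by rewrite orbC; apply: dirE h1 h2.
move=> /coord_at -> /coord_at ->; have i_le := ltn_ord i.
have /andP[e_adj _] := valP e.
case: ifP (src_total e_adj) => [ab _|_ /= ba]; first exact: cpos_up.
rewrite orbC subSS subSn //; apply: cpos_up => //.
by rewrite kC; apply: leq_subr.
Qed.

Lemma subdivided_caterpillar_comb : exists n L R,
  [/\ 0 < L, 1 < n, all (fun r => 0 < r < n) R & iso (subdivide k) (comb n L R)].
Proof.
exists n, r.+1, R; split=> //.
- have := @off_lt 0 1 isT; have q2 : 1 < q by rewrite /q; lia.
  by have := off_lt q2; rewrite /n; lia.
- apply/allP=> t /mapP[y]; rewrite mem_filter => /andP[yP _] ->.
  have [r0 rP _ _] := rtP yP; have := off_lt r0.
  have rq : rt y < q by rewrite /q; lia.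
  by have := off_lt rq; rewrite /n; lia.
- apply: (iso_comb coord_inj coord_in coord_on) => x y.
  apply/idP/idP => [/coord_adj //|/orP[/coord_up //|/coord_up]].
  by rewrite adj_sym.
Qed.

End CoordinatesOfVertices.

(** * Ordering the legs *)

Definition rsum (R : seq nat) (x : nat -> nat) (r : nat) : nat :=
  \sum_(c < size R | nth 0 R c == r) x c.

Lemma eq_rsum R x y r : (forall c, c < size R -> x c = y c) -> rsum R x r = rsum R y r.
Proof. by move=> xy; apply: eq_bigr => c _; apply: xy. Qed.

Lemma rsum_cat R1 R2 x r :
  rsum (R1 ++ R2) x r = rsum R1 x r + rsum R2 (fun c => x (size R1 + c)) r.
Proof.
have natE R y : rsum R y r = \sum_(0 <= c < size R | nth 0 R c == r) y c.
  by rewrite big_mkord.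
rewrite !natE size_cat.
rewrite (big_cat_nat (n := size R1)) ?leq_addr //=; congr (_ + _).
  rewrite big_nat_cond [RHS]big_nat_cond; apply: eq_bigl => c.
  by have [cR|] := ltnP c (size R1); rewrite ?andbF // nth_cat cR.
rewrite -{1}[size R1]add0n big_addn addKn.
apply: eq_big => c; last by rewrite addnC.
by rewrite nth_cat ifN ?addnK // -leqNgt leq_addl.
Qed.

Lemma rsum_notin R x r : r \notin R -> rsum R x r = 0.
Proof.
move=> rR; rewrite /rsum big_pred0 // => c; apply: contraNF rR => /eqP <-.
exact: mem_nth.
Qed.

Lemma rsum_ge R x c : c < size R -> x c <= rsum R x (nth 0 R c).
Proof.
by move=> cR; rewrite /rsum (bigD1 (Ordinal cR)) ?eqxx //= leq_addr.
Qed.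

Lemma rsum_uniq R x r : uniq R -> r \in R -> rsum R x r = x (index r R).
Proof.
move=> uR rR; have iP : index r R < size R by rewrite index_mem.
rewrite /rsum (big_pred1 (Ordinal iP)) // => c.
by rewrite -[r in LHS](nth_index 0 rR) nth_uniq.
Qed.

(* The last leg of each root is reserved for the largest labels, dealt out in
   increasing order of the sums already fixed at the roots. *)
Lemma exists_injective_order (x base : nat -> nat) (R : seq nat) :
  (forall i j, i < j < size R -> x i < x j) ->
  exists R', [/\ perm_eq R R',
    {in R &, injective (fun r => base r + rsum R' x r)}
  & forall r, r \in R -> exists2 c,
      size R - size (undup R) <= c < size R & nth 0 R' c = r].
Proof.
(* [nres] holds the legs that remain when one leg for each root is set aside. *)
move=> x_lt; have [nres RE] := perm_to_subseq (undup_subseq R).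
pose p r := base r + rsum nres x r.
pose res := sort (fun r r' => p r <= p r') (undup R).
have ures : uniq res by rewrite sort_uniq undup_uniq.
have memres r : (r \in res) = (r \in R) by rewrite mem_sort mem_undup.
have szres : size res = size (undup R) by rewrite size_sort.
have RE' : perm_eq R (nres ++ res).
  by rewrite (permPl RE) perm_sym perm_catC perm_cat2r perm_sort.
have szR : size R = size nres + size res by rewrite (perm_size RE') size_cat.
have sumE r : r \in R -> base r + rsum (nres ++ res) x r = p r + x (size nres + index r res).
  by move=> rR; rewrite rsum_cat addnA (@rsum_uniq res) ?memres.
have p_le i j : i <= j -> j < size res -> p (nth 0 res i) <= p (nth 0 res j).
  move=> ij jr; pose le r r' := p r <= p r'.
  have tr : transitive le by move=> a b c; apply: leq_trans.
  have rf : reflexive le by move=> a; apply: leqnn.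
  have so : sorted le res by apply: sort_sorted => a b; apply: leq_total.
  by apply: (sorted_leq_nth tr rf 0 so); rewrite ?inE // (leq_ltn_trans ij).
exists (nres ++ res); split=> // [r r' rR r'R|r rR].
  rewrite /= !sumE //.
  wlog: r r' rR r'R / index r res <= index r' res.
    move=> H e; have [le|/ltnW le] := leqP (index r res) (index r' res); first exact: H.
    by apply/esym/H.
  rewrite leq_eqVlt => /predU1P[e _|lt].
    by rewrite -[r](nth_index 0 (s := res)) ?memres // e nth_index ?memres.
  have r'lt : index r' res < size res by rewrite index_mem memres.
  have := p_le _ _ (ltnW lt) r'lt; rewrite !nth_index ?memres //.
  have := x_lt (size nres + index r res) (size nres + index r' res).
  by move=> /(_ _) ? ?; lia.
exists (size nres + index r res).
  have : index r res < size res by rewrite index_mem memres.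
  by rewrite -szres; lia.
by rewrite nth_cat ltnNge leq_addr /= addKn nth_index ?memres.
Qed.

(** * Layered labels *)

(* The low labels, in layers [l < L.-1]: besides the legs, layer [l] contains one
   edge of the left arm (the first [A0] spine edges) if [l < A0], and of the
   right arm if [l < A1].  In each layer the left arm comes after [pl] legs and
   the right arm after [pr] legs. *)
Inductive track := LeftArm | RightArm | Leg of nat.

Section Tracks.
Variables (N L A0 A1 pl pr : nat).

(** The number of labels in the layers before [l]: of these layers, [minn l A0] contain an edge of
    the left arm, and [minn l A1] one of the right arm. *)
Definition layer_base l := l * N + minn l A0 + minn l A1.

Definition active (t : track) l : bool :=
  match t with
  | LeftArm => l < A0
  | RightArm => l < A1
  | Leg c => (c < N) && (l < L.-1)
  end.

Definition track_pos (t : track) l : nat :=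
  match t with
  | LeftArm => pl + ((l < A1) && (pr <= pl))
  | RightArm => pr + ((l < A0) && (pl < pr))
  | Leg c => c + ((l < A0) && (pl <= c)) + ((l < A1) && (pr <= c))
  end.

(** The position in a layer where both arms are active. It does not depend on the layer, yet orders
    the active tracks of each layer as [track_pos] does. *)
Definition track_key (t : track) : nat :=
  match t with
  | LeftArm => pl + (pr <= pl)
  | RightArm => pr + (pl < pr)
  | Leg c => c + (pl <= c) + (pr <= c)
  end.

Definition low_label t l := layer_base l + track_pos t l + 1.

Definition low_sum t l := low_label t l + (if 0 < l then low_label t l.-1 else 0).

Hypotheses (plN : pl <= N) (prN : pr <= N).
Hypotheses (A0L : A0 <= L.-1) (A1L : A1 <= L.-1).

Lemma layer_baseS l :
  layer_base l.+1 = layer_base l + (N + (l < A0) + (l < A1)).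
Proof. clear; rewrite /layer_base mulSn; lia. Qed.

Lemma layer_base_le l l' : l <= l' -> layer_base l <= layer_base l'.
Proof.
move=> /subnK <-; elim: (l' - l) => // j IH.
by rewrite addSn layer_baseS (leq_trans IH) // leq_addr.
Qed.

Lemma low_label_bd t l : active t l ->
  layer_base l < low_label t l <= layer_base l.+1.
Proof.
rewrite layer_baseS /low_label; case: t => [||c] /= act; clear -act plN prN.
- by case: (l < A0) act; case: (l < A1) => //=; lia.
- by case: (l < A1) act; case: (l < A0) => //=; lia.
- by case/andP: act => cN _; case: (l < A1); case: (l < A0) => /=; lia.
Qed.

Lemma low_label_le t l : active t l -> l < L.-1 -> low_label t l <= layer_base L.-1.
Proof.
move=> /low_label_bd/andP[_ le] lL; exact: leq_trans le (layer_base_le lL).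
Qed.

Lemma track_key_inj t t' : track_key t = track_key t' -> t = t'.
Proof.
case: t => [||c]; case: t' => [||c'] //=; clear; try lia.
move=> e; congr Leg; lia.
Qed.

Lemma track_pos_lt t t' l : active t l -> active t' l ->
  track_key t < track_key t' -> track_pos t l < track_pos t' l.
Proof.
clear; case: t => [||c]; case: t' => [||c'] //=; try lia;
  by case: (l < A0) => //; case: (l < A1) => //=; lia.
Qed.

Lemma low_label_lt t l t' l' : active t l -> active t' l' ->
  l < l' -> low_label t l < low_label t' l'.
Proof.
move=> /low_label_bd/andP[_ le] /low_label_bd/andP[lt _] ll'.
by apply: leq_ltn_trans le (leq_ltn_trans (layer_base_le ll') lt).
Qed.

Lemma low_label_key_lt t t' l : active t l -> active t' l ->
  track_key t < track_key t' -> low_label t l < low_label t' l.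
Proof.
by move=> act act' /(track_pos_lt act act') lt; rewrite /low_label; lia.
Qed.

Lemma activeW t l l' : l <= l' -> active t l' -> active t l.
Proof. case: t => [||c] /=; lia. Qed.

Lemma active_lt t l : active t l -> l < L.-1.
Proof. case: t => [||c] /=; lia. Qed.

Lemma low_label_inj t l t' l' : active t l -> active t' l' ->
  low_label t l = low_label t' l' -> t = t' /\ l = l'.
Proof.
move=> act act' e; case: (ltngtP l l') => ll.
- by have := low_label_lt act act' ll; lia.
- by have := low_label_lt act' act ll; lia.
split=> //; rewrite -ll in act' e; apply: track_key_inj.
case: (ltngtP (track_key t) (track_key t')) => // lt.
- by have := low_label_key_lt act act' lt; lia.
- by have := low_label_key_lt act' act lt; lia.
Qed.

Lemma low_sum_bd t l : active t l -> low_sum t l <= layer_base L.-1 + layer_base L.-2.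
Proof.
move=> act; have lL := active_lt act; rewrite /low_sum leq_add ?low_label_le //.
case: (ltnP 0 l) => // l0; have act1 := activeW (leq_pred l) act.
have /andP[_ le] := low_label_bd act1.
by apply: leq_trans le (layer_base_le _); lia.
Qed.

(* First in, first out: both labels at a vertex of one leg precede those at
   the next vertex in the order of layers, so the sums increase. *)
Lemma low_sum_inj t l t' l' : active t l -> active t' l' ->
  low_sum t l = low_sum t' l' -> t = t' /\ l = l'.
Proof.
have lt_layer u j u' j' : active u j -> active u' j' -> j < j' -> low_sum u j < low_sum u' j'.
  move=> act act' jj; have lt := low_label_lt act act' jj; rewrite /low_sum.
  have j'0 : 0 < j' by lia.
  rewrite j'0; case: (ltnP 0 j) => j0; last lia.
  have act1 := activeW (leq_pred j) act; have act1' := activeW (leq_pred j') act'.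
  have : low_label u j.-1 < low_label u' j'.-1 by apply: low_label_lt => //; lia.
  lia.
have lt_key u u' j : active u j -> active u' j -> track_key u < track_key u' ->
    low_sum u j < low_sum u' j.
  move=> act act' key; have lt := low_label_key_lt act act' key; rewrite /low_sum.
  case: (ltnP 0 j) => j0; last lia.
  have act1 := activeW (leq_pred j) act; have act1' := activeW (leq_pred j) act'.
  by have := low_label_key_lt act1 act1' key; lia.
move=> act act' e; case: (ltngtP l l') => ll.
- by have := lt_layer _ _ _ _ act act' ll; lia.
- by have := lt_layer _ _ _ _ act' act ll; lia.
split=> //; rewrite -ll in act' e; apply: track_key_inj.
case: (ltngtP (track_key t) (track_key t')) => // lt.
- by have := lt_key _ _ _ act act' lt; lia.
- by have := lt_key _ _ _ act' act lt; lia.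
Qed.

End Tracks.

(** * Layered low labels combined with arbitrary high labels *)

Section LowHigh.
Variables (n L : nat) (R : seq nat) (A0 A1 pl pr : nat) (f x : nat -> nat).
Let N := size R.
Let m := n + N * L.
Let B := layer_base N A0 A1 L.-1.
Let low := low_label N A0 A1 pl pr.

Hypotheses (L_gt1 : 1 < L) (N_gt0 : 0 < N).
Hypotheses (A0_bd : 0 < A0 <= L.-1) (A1_bd : 0 < A1 <= L.-1) (A0A1 : A0 + A1 <= n).
Hypothesis R_bd : forall r, r \in R -> A0 <= r <= n - A1.
Hypotheses (plN : pl <= N) (prN : pr <= N).
Hypothesis f_bd : forall i, A0 < i <= n - A1 -> B < f i <= m.
Hypothesis x_bd : forall c, c < N -> B < x c <= m.
Hypothesis f_inj : forall i j, A0 < i <= n - A1 -> A0 < j <= n - A1 -> f i = f j -> i = j.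
Hypothesis x_lt : forall c d, c < d < N -> x c < x d.
Hypothesis f_x : forall i c, A0 < i <= n - A1 -> c < N -> f i <> x c.

(** At [A0] and [n - A1], one of the two spine edges is the last edge of an arm and has a low
    label. *)
Definition high_sum i :=
  (if i == A0 then low LeftArm A0.-1 else f i)
  + (if i == n - A1 then low RightArm A1.-1 else f i.+1) + rsum R x i.

Definition top_sum c := x c + low (Leg c) L.-2.

Hypothesis high_gt : forall i, A0 <= i <= n - A1 -> B + layer_base N A0 A1 L.-2 < high_sum i.
Hypothesis high_inj : forall i j, A0 <= i <= n - A1 -> A0 <= j <= n - A1 ->
  odd i = odd j -> high_sum i = high_sum j -> i = j.
Hypothesis high_top : forall i c, A0 <= i <= n - A1 -> c < N ->
  odd i = ~~ odd (nth 0 R c) -> high_sum i <> top_sum c.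

Let e i :=
  if i <= A0 then low LeftArm i.-1
  else if i <= n - A1 then f i else low RightArm (n - i).

Let lab c l := if l < L.-1 then low (Leg c) l else x c.

Let B_m : B <= m.
Proof.
rewrite /B /m /layer_base (minn_idPr (proj2 (andP A0_bd))) (minn_idPr (proj2 (andP A1_bd))).
have : L.-1 * N <= N * L by rewrite mulnC leq_mul2l leq_pred orbT.
lia.
Qed.

Let eE i : 0 < i <= n ->
  [\/ [/\ i <= A0, active N L A0 A1 LeftArm i.-1 & e i = low LeftArm i.-1],
      A0 < i <= n - A1 /\ e i = f i
    | [/\ n - A1 < i, active N L A0 A1 RightArm (n - i) & e i = low RightArm (n - i)]].
Proof.
move=> i_bd; rewrite /e; case: leqP => iA0; first by constructor 1; split=> //=; lia.
by case: leqP => iA1; [constructor 2; split=> // | constructor 3; split=> //=]; lia.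
Qed.

Let labE c l : c < N -> l < L ->
  (active N L A0 A1 (Leg c) l /\ lab c l = low (Leg c) l) \/ (l = L.-1 /\ lab c l = x c).
Proof.
move=> cN lL; rewrite /lab; case: (ltnP l L.-1) => ll; [left | right]; split=> //.
  by rewrite /= cN.
lia.
Qed.

Let A0L : A0 <= L.-1. Proof. by case/andP: A0_bd. Qed.
Let A1L : A1 <= L.-1. Proof. by case/andP: A1_bd. Qed.

Let low_bd t l : active N L A0 A1 t l -> 0 < low t l <= B.
Proof.
move=> act; have lt := active_lt plN prN A0L A1L act; apply/andP; split.
  by rewrite /low /low_label addn1.
exact: low_label_le.
Qed.

Let x_inj c d : c < N -> d < N -> x c = x d -> c = d.
Proof.
move=> cN dN; case: (ltngtP c d) => // cd.
  by have := @x_lt c d; rewrite cd dN => /(_ isT); lia.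
by have := @x_lt d c; rewrite cd cN => /(_ isT); lia.
Qed.

Let vert_low i : i <= n -> (i < A0) || (n - A1 < i) ->
  exists t l, [/\ active N L A0 A1 t l, (if t is Leg _ then false else true),
    spine_sum n L R e lab i = low_sum N A0 A1 pl pr t l
    & i = (if t is LeftArm then l else n - l)].
Proof.
move=> i_le i_out; have noR : rsum R (lab ^~ L.-1) i = 0.
  by apply: rsum_notin; apply/negP => /R_bd; lia.
rewrite /spine_sum -/(rsum R (lab ^~ L.-1) i) noR addn0 /low_sum.
have [iA0|iA0] := ltnP i A0.
  exists LeftArm, i; split=> //=; rewrite /e; have -> : i < n by lia.
  by rewrite iA0 (ltnW iA0) /= addnC.
have iA1 : n - A1 < i by lia.
exists RightArm, (n - i); split=> //=; try lia.
rewrite /e; have -> : 0 < i by lia.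
have -> : (i <= A0) = false by lia.
have -> : (i <= n - A1) = false by lia.
congr (_ + _); have -> : (0 < n - i) = (i < n) by lia.
case: ifP => // i_n; have -> : (i < A0) = false by lia.
have -> : (i < n - A1) = false by lia.
by congr low; lia.
Qed.

Let vert_high i : A0 <= i <= n - A1 -> spine_sum n L R e lab i = high_sum i.
Proof.
move=> i_bd; rewrite /spine_sum /high_sum -/(rsum R (lab ^~ L.-1) i).
have -> : rsum R (lab ^~ L.-1) i = rsum R x i.
  by apply: eq_rsum => c _; rewrite /lab ltnn.
have -> : 0 < i by lia.
have -> : i < n by lia.
congr (_ + _ + _); rewrite /e.
  case: eqP => [->|ne]; first by rewrite leqnn.
  have -> : (i <= A0) = false by lia.
  by have -> : i <= n - A1 by lia.
have -> : (i < A0) = false by lia.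
case: eqP => [->|ne]; last by have -> : i < n - A1 by lia.
by rewrite ltnn; congr low; lia.
Qed.

Let leg_low c l : c < N -> l < L.-1 ->
  leg_sum lab c l = low_sum N A0 A1 pl pr (Leg c) l.
Proof.
move=> cN lL; rewrite /leg_sum /lab lL /low_sum.
by case: ifP => // l0; rewrite ifT //; lia.
Qed.

Let leg_top c : leg_sum lab c L.-1 = top_sum c.
Proof.
rewrite /leg_sum /lab ltnn /top_sum; have -> : 0 < L.-1 by lia.
by have -> : L.-2 < L.-1 by lia.
Qed.

Let top_lt c d : c < d < N -> top_sum c < top_sum d.
Proof.
move=> cd; have xx := x_lt cd; rewrite /top_sum.
suff : low (Leg c) L.-2 < low (Leg d) L.-2 by lia.
have actc : active N L A0 A1 (Leg c) L.-2 by rewrite /=; lia.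
have actd : active N L A0 A1 (Leg d) L.-2 by rewrite /=; lia.
apply: (low_label_key_lt plN prN A0L A1L actc actd); rewrite /=; clear -cd; lia.
Qed.

Let top_gt c : c < N -> B + layer_base N A0 A1 L.-2 < top_sum c.
Proof.
move=> cN; have := x_bd cN; rewrite /top_sum.
have act : active N L A0 A1 (Leg c) L.-2 by rewrite /= cN; lia.
by have := low_label_bd plN prN act; rewrite -/low; lia.
Qed.

(** Sums of low labels are distinct by the layering and at most [B + layer_base N A0 A1 L.-2], which
    all other sums exceed. Top sums increase with the leg, as both of their labels do. A top vertex
    is adjacent to its root, hence in the opposite class, so [high_top] covers the remaining
    conflicts. *)
Lemma low_high_admits : admits_antimagic_orientation (comb n L R).
Proof.
have low_le t l : active N L A0 A1 t l ->
    low_sum N A0 A1 pl pr t l <= B + layer_base N A0 A1 L.-2.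
  by move=> act; apply: low_sum_bd act.
apply: (@comb_bipartite_admits n L R e lab); rewrite -/N -/m.
- by lia.
- by lia.
- by apply/allP => r /R_bd; lia.
- move=> i /eE[[_ /low_bd bd ->]|[i_bd ->]|[_ /low_bd bd ->]]; try lia.
  by have := f_bd i_bd; lia.
- move=> c l cN lL; have [[/low_bd bd ->]|[_ ->]] := labE cN lL; first lia.
  by have := x_bd cN; lia.
- move=> i j i_bd j_bd.
  case: (eE i_bd) => [[iA act ->]|[i_f ->]|[iA act ->]];
  case: (eE j_bd) => [[jA act' ->]|[j_f ->]|[jA act' ->]] eq_lab.
  + by have [_] := low_label_inj plN prN A0L A1L act act' eq_lab; lia.
  + by have := low_bd act; have := f_bd j_f; lia.
  + by have [] := low_label_inj plN prN A0L A1L act act' eq_lab.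
  + by have := low_bd act'; have := f_bd i_f; lia.
  + exact: f_inj.
  + by have := low_bd act'; have := f_bd i_f; lia.
  + by have [] := low_label_inj plN prN A0L A1L act act' eq_lab.
  + by have := low_bd act; have := f_bd j_f; lia.
  + by have [_] := low_label_inj plN prN A0L A1L act act' eq_lab; lia.
- move=> c l d k cN lL dN kL.
  case: (labE cN lL) => -[act ->]; case: (labE dN kL) => -[act' ->] eq_lab.
  + by have [[->] ->] := low_label_inj plN prN A0L A1L act act' eq_lab.
  + by have := low_bd act; have := x_bd dN; lia.
  + by have := low_bd act'; have := x_bd cN; lia.
  + by rewrite (x_inj cN dN eq_lab) act act'.
- move=> i c l i_bd cN lL.
  case: (eE i_bd) => [[iA act ->]|[i_f ->]|[iA act ->]];
  case: (labE cN lL) => -[act' ->] eq_lab.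
  + by have [] := low_label_inj plN prN A0L A1L act act' eq_lab.
  + by have := low_bd act; have := x_bd cN; lia.
  + by have := low_bd act'; have := f_bd i_f; lia.
  + exact: f_x eq_lab.
  + by have [] := low_label_inj plN prN A0L A1L act act' eq_lab.
  + by have := low_bd act; have := x_bd cN; lia.
- move=> i j i_le j_le par.
  have [i_out|i_in] := boolP ((i < A0) || (n - A1 < i));
  have [j_out|j_in] := boolP ((j < A0) || (n - A1 < j)).
  + have [t [l [act ar -> ->]]] := vert_low i_le i_out.
    have [t' [l' [act' ar' -> ->]]] := vert_low j_le j_out.
    by move=> /(low_sum_inj plN prN A0L A1L act act')[-> ->].
  + have [t [l [act ar -> _]]] := vert_low i_le i_out.
    have j_bd : A0 <= j <= n - A1 by lia.
    by rewrite vert_high //; have := high_gt j_bd; have := low_le _ _ act; lia.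
  + have [t [l [act ar -> _]]] := vert_low j_le j_out.
    have i_bd : A0 <= i <= n - A1 by lia.
    by rewrite vert_high //; have := high_gt i_bd; have := low_le _ _ act; lia.
  + have i_bd : A0 <= i <= n - A1 by lia.
    have j_bd : A0 <= j <= n - A1 by lia.
    by rewrite !vert_high //; apply: high_inj.
- move=> c l d k cN lL dN kL _.
  have [l_low|l_top] := ltnP l L.-1; have [k_low|k_top] := ltnP k L.-1.
  + rewrite !leg_low // => /(low_sum_inj plN prN A0L A1L) [] //=; rewrite ?cN ?dN //.
    by move=> [->] ->.
  + have -> : k = L.-1 by lia.
    rewrite leg_low // leg_top; have := top_gt dN.
    have : active N L A0 A1 (Leg c) l by rewrite /= cN.
    by move/low_le; lia.
  + have -> : l = L.-1 by lia.
    rewrite (leg_low dN k_low) leg_top; have := top_gt cN.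
    have : active N L A0 A1 (Leg d) k by rewrite /= dN.
    by move/low_le; lia.
  + have -> : k = L.-1 by lia.
    have -> : l = L.-1 by lia.
    rewrite !leg_top; case: (ltngtP c d) => // cd e'.
    * by have := @top_lt c d; rewrite cd dN => /(_ isT); lia.
    * by have := @top_lt d c; rewrite cd cN => /(_ isT); lia.
- move=> i c l i_le cN lL par.
  have [l_low|l_top] := ltnP l L.-1.
    rewrite leg_low //; have act' : active N L A0 A1 (Leg c) l by rewrite /= cN.
    have [i_out|i_in] := boolP ((i < A0) || (n - A1 < i)).
      have [t [l' [act ar -> _]]] := vert_low i_le i_out.
      by move=> /(low_sum_inj plN prN A0L A1L act act')[tE _]; rewrite tE in ar.
    have i_bd : A0 <= i <= n - A1 by lia.
    by rewrite vert_high //; have := high_gt i_bd; have := low_le _ _ act'; lia.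
  have lE : l = L.-1 by lia.
  rewrite lE in par *; rewrite leg_top.
  have [i_out|i_in] := boolP ((i < A0) || (n - A1 < i)).
    have [t [l' [act ar -> _]]] := vert_low i_le i_out.
    by have := low_le _ _ act; have := top_gt cN; lia.
  have i_bd : A0 <= i <= n - A1 by lia.
  rewrite vert_high //; apply: high_top => //; rewrite par /leg_class.
  by have -> : nth 0 R c + L - L.-1 = (nth 0 R c).+1 by lia.
Qed.

End LowHigh.

(** * Two long arms *)

(* Labels [B + 1, ..., B + K] for the [K] spine edges after the first [A], counted
   down from the right end: every second edge from the middle of the range, the
   others from its top, so that both end edges have labels at most
   [B + K./2 + 1]. *)
Definition mid_label A K B i :=
  let d := A + K - i in if odd d then B + K - d./2 else B + uphalf K - d./2.

Lemma mid_label_first A K B : 1 < K ->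
  odd K && (mid_label A K B A.+1 == B + 1)
  || ~~ odd K && (mid_label A K B A.+1 == B + K./2 + 1).
Proof.
rewrite /mid_label; have -> : A + K - A.+1 = K.-1 by lia.
by case: ifP; lia.
Qed.

Lemma mid_label_last A K B : mid_label A K B (A + K) = B + uphalf K.
Proof. by rewrite /mid_label subnn /= subn0. Qed.

(* The gap is the last edge of one of the two arms, placed after the [g] legs of
   [Fs] in each layer.  Its junction with the middle of the spine might collide
   with a leg of [Fs], but for at most one of the arms. *)
Section LongArms.
Variables (L K n : nat) (Fs Gs : seq nat) (pl pr : nat).
Let R := Fs ++ Gs.
Let N := size R.
Let g := size Fs.
Let A := L.-1.
Let B := layer_base N A A A.
Let Y := (layer_base N A A L.-2).+1.

Hypotheses (L_gt1 : 1 < L) (nE : n = A + K + A) (K_gt1 : 1 < K) (N_gt0 : 0 < N).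
Hypothesis R_bd : forall r, r \in R -> A < r < A + K.

Let mid := mid_label A K B.
Let x c := B + K + c + 1.

Hypothesis plr : (pl == g) && (pr == 0) || [&& pl == 0, pr == g & 0 < g].
Hypothesis F_odd : forall r, r \in Fs -> odd (uphalf K + A + r + Y + B + K).
Hypothesis G_even : forall r, r \in Gs -> ~~ odd (uphalf K + A + r + Y + B + K).
Hypothesis left_gap : pr = 0 -> forall r, r \in Fs -> odd r = ~~ odd A ->
  odd (g + 1 + mid A.+1 + B + K).
Hypothesis right_gap : pl = 0 -> 0 < g -> forall r, r \in Fs -> odd r = ~~ odd (A + K) ->
  odd (g + 1 + mid (A + K) + B + K).
Hypothesis R_inj : {in R &, forall r r', odd r = odd r' ->
  mid r + mid r.+1 + rsum R x r = mid r' + mid r'.+1 + rsum R x r' ->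
  r = r'}.

Let YB : B = Y + N + 1.
Proof.
rewrite /B /Y /A; have -> : L.-1 = L.-2.+1 by lia.
rewrite layer_baseS; have -> : L.-2 < L.-2.+1 by [].
by rewrite /=; clear; lia.
Qed.

Let gN : g <= N. Proof. by rewrite /N /R size_cat leq_addr. Qed.
Let plN : pl <= N. Proof. by move: plr gN; clear; lia. Qed.
Let prN : pr <= N. Proof. by move: plr gN; clear; lia. Qed.

Let mid_bd i : A < i <= A + K -> B < mid i <= B + K.
Proof. by rewrite /mid /mid_label; clear; case: ifP; lia. Qed.

Let mid_inj i j : A < i <= A + K -> A < j <= A + K -> mid i = mid j -> i = j.
Proof. by rewrite /mid /mid_label; clear; case: ifP; case: ifP; lia. Qed.

(** Passing to the next edge switches between the two decreasing runs; the halves of [d] and [d.+1]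
    add up to [d], so the sums are consecutive integers. *)
Let mid_sum i : A < i < A + K ->
  mid i + mid i.+1 + (A + K) = 2 * B + K + uphalf K + i.+1.
Proof. by rewrite /mid /mid_label; clear; case: ifP; case: ifP; lia. Qed.

Let y c : low_label N A A pl pr (Leg c) L.-2 = Y + c + (pl <= c) + (pr <= c).
Proof.
rewrite /low_label /=; have -> : L.-2 < A by rewrite /A; clear -L_gt1; lia.
by rewrite /Y; clear; lia.
Qed.

Let alpha : low_label N A A pl pr LeftArm L.-2 = Y + pl + (pr <= pl).
Proof.
rewrite /low_label /=; have -> : L.-2 < A by rewrite /A; clear -L_gt1; lia.
by rewrite /Y; clear; lia.
Qed.

Let alpha' : low_label N A A pl pr RightArm L.-2 = Y + pr + (pl < pr).
Proof.
rewrite /low_label /=; have -> : L.-2 < A by rewrite /A; clear -L_gt1; lia.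
by rewrite /Y; clear; lia.
Qed.

Let hs := high_sum n R A A pl pr mid x.

Let nA : n - A = A + K. Proof. by rewrite nE addnK. Qed.

Let hsL : hs A = Y + pl + (pr <= pl) + mid A.+1.
Proof.
rewrite /hs /high_sum eqxx nA rsum_notin; last by apply/negP => /R_bd; rewrite ltnn.
have -> : A == A + K = false by clear -K_gt1; lia.
by rewrite addn0 -alpha.
Qed.

Let hsR : hs (A + K) = mid (A + K) + (Y + pr + (pl < pr)).
Proof.
rewrite /hs /high_sum nA eqxx rsum_notin; last by apply/negP => /R_bd; rewrite ltnn andbF.
have -> : A + K == A = false by clear -K_gt1; lia.
by rewrite addn0 -alpha'.
Qed.

Let hsM i : A < i < A + K -> hs i = mid i + mid i.+1 + rsum R x i.
Proof.
move=> i_bd; rewrite /hs /high_sum nA.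
have -> : i == A = false by clear -i_bd; lia.
by have -> : i == A + K = false by clear -i_bd; lia.
Qed.

Let hs_root r : r \in R -> 3 * B + K + uphalf K + 3 <= hs r.
Proof.
move=> rR; have r_bd := R_bd rR; have sE := mid_sum r_bd; rewrite hsM //.
have [iR <-] : index r R < size R /\ nth 0 R (index r R) = r by rewrite index_mem nth_index.
have := rsum_ge x iR; rewrite nth_index //; move: sE r_bd.
by rewrite {1}/x; clear -K_gt1; move: (rsum _ _ _) => s; lia.
Qed.

Let hs_nonroot i : A <= i <= A + K -> i \notin R ->
  [\/ i = A /\ hs i = Y + pl + (pr <= pl) + mid A.+1,
      i = A + K /\ hs i = mid (A + K) + (Y + pr + (pl < pr))
    | A < i < A + K /\ hs i + (A + K) = 2 * B + K + uphalf K + i.+1].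
Proof.
move=> i_bd iR; have [->|iA] := eqVneq i A; first by constructor 1; rewrite hsL.
have [->|iK] := eqVneq i (A + K); first by constructor 2; rewrite hsR.
have i_bd' : A < i < A + K by clear -i_bd iA iK; lia.
by constructor 3; split; rewrite // hsM // rsum_notin // addn0 mid_sum.
Qed.

Let mE : n + N * L = B + K + N.
Proof.
rewrite /B /layer_base !minnn nE mulnC; have -> : L = A.+1 by rewrite /A prednK // ltnW.
by rewrite mulSn; clear; lia.
Qed.

Let xE c : x c = B + K + c + 1. Proof. by []. Qed.

Let mid_first : odd K && (mid A.+1 == B + 1) || ~~ odd K && (mid A.+1 == B + K./2 + 1).
Proof. exact: mid_label_first. Qed.
Let mid_last : mid (A + K) = B + uphalf K.
Proof. exact: mid_label_last. Qed.

(** One arm precedes all legs and the other one is the gap after [g] legs, so the parity of the top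
    sums flips at leg [g]. [F_odd] and [G_even] say that this parity differs from that of the sums
    in [mid_sum] at vertices of the class opposite to the root. *)
Let wE c : c < N -> top_sum L R A A pl pr x c =
  B + K + Y + 2 * c + 2 + (g <= c).
Proof. by move=> cN; rewrite /top_sum -/N y xE; move: plr; clear; lia. Qed.

Let nth_root c : c < N -> 
  if c < g then nth 0 R c \in Fs else nth 0 R c \in Gs.
Proof.
move=> cN; rewrite nth_cat -/g; case cg: (c < g); first exact: mem_nth.
have gc : size Fs <= c by rewrite leqNgt -/g cg.
by apply: mem_nth; rewrite -(ltn_add2l (size Fs)) subnKC // -size_cat.
Qed.

(** Root sums are largest. The junction at the arm without the gap has a sum below every top sum.
    The other junction stays below the top sums of [Gs], and the gap hypotheses separate it by
    parity from those of [Fs]. *)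
Lemma long_arms_admits : admits_antimagic_orientation (comb n L R).
Proof.
have A_gt0 : 0 < A by rewrite /A; clear -L_gt1; lia.
apply: (@low_high_admits n L R A A pl pr mid x) => //;
  rewrite ?nA -?/N ?mE -?/A -?/B.
- by rewrite A_gt0 leqnn.
- by rewrite A_gt0 leqnn.
- by rewrite nE; clear; lia.
- by move=> r /R_bd; clear; lia.
- by move=> i /mid_bd; clear; lia.
- by move=> c cN; rewrite xE; clear -cN; lia.
- exact: mid_inj.
- by move=> c d; rewrite !xE; clear; lia.
- by move=> i c /mid_bd i_bd _; rewrite xE; clear -i_bd; lia.
- move=> i i_bd; rewrite -/hs.
  have YE : layer_base N A A A.-1 = Y.-1 by [].
  rewrite YE; have [iR|iR] := boolP (i \in R).
    by have := hs_root iR; rewrite YB; clear; lia.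
  have := mid_bd; have := hs_nonroot i_bd iR; rewrite YB; clear -K_gt1.
  move=> hsi bd; case: hsi => -[? hsi].
  + have := bd A.+1; lia.
  + have := bd (A + K); lia.
  + lia.
- move=> i j i_bd j_bd par; rewrite -/hs.
  have [iR|iR] := boolP (i \in R); have [jR|jR] := boolP (j \in R).
  + by rewrite !hsM ?R_bd //; apply: R_inj.
  + have := hs_root iR; have := hs_nonroot j_bd jR; rewrite mid_last.
    by move: mid_first plr gN YB K_gt1; clear => ? ? ? ? ? [] [? ?]; lia.
  + have := hs_root jR; have := hs_nonroot i_bd iR; rewrite mid_last.
    by move: mid_first plr gN YB K_gt1; clear => ? ? ? ? ? [] [? ?]; lia.
  + have := hs_nonroot i_bd iR; have := hs_nonroot j_bd jR; rewrite mid_last.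
    by move: par mid_first plr gN YB K_gt1; clear => ? ? ? ? ? ? [] [? ?] [] [? ?]; lia.
- move=> i c i_bd cN par; rewrite -/hs wE //.
  have [iR|iR] := boolP (i \in R).
    by have := hs_root iR; rewrite YB; move: cN; clear; lia.
  have gap : pr == 0 \/ (pl == 0) && (0 < g).
    by case/orP: plr => [/andP[_]|/and3P[-> _]]; [left | right].
  have := nth_root cN; move: par; move: (nth 0 R c) => r par.
  have := hs_nonroot i_bd iR; rewrite mid_last.
  case: ifP => cg; [move=> hsi rF | move=> hsi rG].
  + have := F_odd rF; have := left_gap _ rF; have := right_gap _ _ rF; rewrite mid_last.
    move: mid_first gap; case: hsi => -[iE hsi].
    * move: hsi par plr cg K_gt1; rewrite iE; clear => hsi par plr cg K1 mf [p|p] rg lg fo.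
        have {}lg : odd (g + 1 + mid A.+1 + B + K) by apply: lg (eqP p) _; rewrite par negbK.
        by clear rg fo par; lia.
      by clear lg rg fo par; lia.
    * move: hsi par plr cg K_gt1; rewrite iE; clear => hsi par plr cg K1 mf [p|p] rg lg fo.
        by clear lg rg fo par; lia.
      case/andP: p => /eqP p g0.
      have {}rg : odd (g + 1 + (B + uphalf K) + B + K) by apply: rg p g0 _; rewrite par negbK.
      by clear lg fo par mf; lia.
    * by move: hsi par plr cg K_gt1; clear => hsi par plr cg K1 mf _ _ _ fo; lia.
  + have := G_even rG; move: mid_first; case: hsi => -[iE hsi];
    move: iE hsi par plr cg K_gt1 cN; clear => iE hsi par plr cg K1 cN mf ge; lia.
Qed.

End LongArms.

(** The roots are far enough from both ends for arms of [L.-1] edges to stop before them. [P]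
    depends only on the parity of a root, so the legs of one root all go to [Fs] or all to [Gs]. *)
Lemma comb_long_arms n L R : 1 < L -> 0 < size R ->
  (forall r, r \in R -> L <= r <= n - L) ->
  admits_antimagic_orientation (comb n L R).
Proof.
move=> L1 R0 R_bd; set A := L.-1; set K := n - A - A; set N := size R.
pose B := layer_base N A A A; pose Y := (layer_base N A A L.-2).+1.
pose P r := odd (uphalf K + A + r + Y + B + K).
pose x c := B + K + c + 1; pose mid := mid_label A K B.
have [Fs [Fperm F_inj _]] := @exists_injective_order x
  (fun r => mid r + mid r.+1) [seq r <- R | P r] ltac:(rewrite /x; clear; lia).
pose x' c := x (size Fs + c).
have [Gs [Gperm G_inj _]] := @exists_injective_order x'
  (fun r => mid r + mid r.+1) [seq r <- R | ~~ P r] ltac:(rewrite /x' /x; clear; lia).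
have FP r : (r \in Fs) = (r \in R) && P r by rewrite -(perm_mem Fperm) mem_filter andbC.
have GP r : (r \in Gs) = (r \in R) && ~~ P r by rewrite -(perm_mem Gperm) mem_filter andbC.
have permR : perm_eq R (Fs ++ Gs).
  by rewrite -(perm_filterC P R); apply: perm_cat.
apply: (iso_admits (comb_perm_iso n L permR)).
have NE : size (Fs ++ Gs) = N by rewrite -(perm_size permR).
have r_bd r : r \in R -> A < r < A + K.
  by move=> /R_bd; rewrite /K /A; clear -L1; lia.
have [r0 r0R] : exists r, r \in R by case: (R) R0 => // r s _; exists r; rewrite mem_head.
have K1 : 1 < K by have := R_bd _ r0R; rewrite /K /A; clear -L1; lia.
have nE : n = A + K + A by have := R_bd _ r0R; rewrite /K /A; clear -L1; lia.
set g := size Fs.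
(* [b] means that a gap on the left arm might collide with a leg of [Fs]; the gap then goes to the
   right arm. *)
pose b := has (fun r => odd r == ~~ odd A) Fs && ~~ odd (g + 1 + mid A.+1 + B + K).
have mid1 : odd K && (mid A.+1 == B + 1) || ~~ odd K && (mid A.+1 == B + K./2 + 1).
  exact: mid_label_first.
have mid2 : mid (A + K) = B + uphalf K := mid_label_last A K B.
apply: (@long_arms_admits L K n Fs Gs (if b then 0 else g) (if b then g else 0));
  rewrite ?NE -/A -/N -/B -/Y -/mid -/g //.
- by move=> r; rewrite -(perm_mem permR); apply: r_bd.
- rewrite /b; case: hasP => [[r rF _]|_] /=; last by rewrite !eqxx.
  have -> : 0 < g by rewrite /g; case: (Fs) rF.
  by case: ifP; rewrite !eqxx ?orbT.
- by move=> r; rewrite FP => /andP[].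
- by move=> r; rewrite GP => /andP[].
- rewrite /b => + r rF rA; have -> : has (fun r => odd r == ~~ odd A) Fs.
    by apply/hasP; exists r; rewrite ?rA.
  case: ifP => //= [_ g0|/negbFE //]; move: rF; rewrite /g in g0.
  by rewrite (size0nil g0).
(* The roots in [Fs] have one parity, so a threat at both junctions forces [K] to be even. Then the
   two end edges of the middle have consecutive labels, and only one of the two parities is bad. *)
- case: ifP => [|_ -> //] /andP[/hasP[r1 r1F /eqP r1A] ev] _ _ r rF rA.
  move: r1F rF; rewrite !FP => /andP[_ +] /andP[_]; rewrite /P mid2.
  by move: mid1 ev r1A rA K1; clear; lia.
- have rsF r : r \in Fs -> rsum (Fs ++ Gs) x r = rsum Fs x r.
    move=> rF; rewrite rsum_cat [X in _ + X]rsum_notin ?addn0 //.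
    by move: rF; rewrite FP GP => /andP[_ ->]; rewrite andbF.
  have rsG r : r \in Gs -> rsum (Fs ++ Gs) x r = rsum Gs x' r.
    move=> rG; rewrite rsum_cat rsum_notin //.
    by move: rG; rewrite FP GP => /andP[_ /negbTE->]; rewrite andbF.
  move=> r r'; rewrite !mem_cat => /orP[] rI /orP[] r'I par.
  + by rewrite !rsF //; apply: F_inj; rewrite -/(_ \in _) (perm_mem Fperm).
  + move: rI r'I; rewrite FP GP => /andP[_ p1] /andP[_ p2]; exfalso.
    by move: p1 p2 par; rewrite /P; clear; lia.
  + move: rI r'I; rewrite FP GP => /andP[_ p1] /andP[_ p2]; exfalso.
    by move: p1 p2 par; rewrite /P; clear; lia.
  + by rewrite !rsG //; apply: G_inj; rewrite -/(_ \in _) (perm_mem Gperm).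
Qed.

(** * A short arm *)

(* The gap is the label [B + nb + g] of the last middle edge, which is next to a
   root, among the labels of the leg edges at the roots.  If [ext], the first
   middle edge is next to a root as well and gets the largest label [m]. *)
Definition end_label A0 K B nb g m (ext : bool) i :=
  let d := A0 + K - i in
  if d == 0 then B + nb + g
  else if ext && (i == A0.+1) then m
  else if odd d then B + nb./2 - d./2 else B + nb - d./2.

Ltac split_andb :=
  repeat match goal with H : is_true (_ && _) |- _ => case/andP: H => ? ? end.

(* The right arm is shorter than a leg, and the left one is iff [~~ long]. [Fb] and
   [Ft] contain the roots of one parity, [Gs] those of the other one.  If [g] is
   odd, the gap also shifts the largest spine sum [s0] by an odd number; where
   this could hurt, one leg, [Ft], is moved behind the others: its sum [wN]
   exceeds all spine sums. *)
Section ShortArm.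
Variables (L n A0 A1 K : nat) (long : bool) (Fb Gs Ft : seq nat).
Let R := Fb ++ Gs ++ Ft.
Let N := size R.
Let g := size Fb.
(** For odd [K] the zigzag gives the first middle edge the label [B + uphalf K], enough for a root
    at [A0]; for even [K] it would give only [B + 1]. *)
Let ext := [&& ~~ long, ~~ odd K & 0 < K].
Let nb := K - ext.
(** The last edge of an arm that ends at a root needs a label above [N]. This is automatic beyond
    layer 0; in layer 0 the arm is placed after all legs. A long arm comes before the legs, which
    keeps the sum at its non-root junction small. *)
Let pl := if ~~ long && (A0 == 1) then N else 0.
Let pr := if A1 == 1 then N else 0.
Let B := layer_base N A0 A1 L.-1.
Let Y := (layer_base N A0 A1 L.-2
  + ((L.-2 < A0) && (pl == 0)) + ((L.-2 < A1) && (pr == 0))).+1.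
Let W := B + nb.
Let m := B + K + N.
Let f := end_label A0 K B nb g m ext.
Let x c := W + c + (g <= c).
Let alpha := low_label N A0 A1 pl pr LeftArm A0.-1.
Let alpha' := low_label N A0 A1 pl pr RightArm A1.-1.
Let hs := high_sum n R A0 A1 pl pr f x.
Let s0 := 2 * B + nb + nb./2.
Let wN := W + Y + 2 * N - 1.
(** For [i] and [r] of opposite parities, [P r] says that the unshifted zigzag sum at [i] differs in
    parity from the top sums [W + Y + 2 * c] before the gap; beyond the gap top sums have the other
    parity. *)
Let P r := odd (nb + nb./2 + r + A0 + K + W + Y).

Hypotheses (L_gt1 : 1 < L) (N_gt0 : 0 < N) (nE : n = A0 + K + A1).
Hypotheses (A0_bd : 0 < A0 <= L.-1) (A1_bd : 0 < A1 <= L.-1).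
Hypothesis R_bd : forall r, r \in R -> A0 + long <= r <= A0 + K.
Hypothesis left_long : long -> A0 = L.-1.
Hypothesis left_root : ~~ long -> A0 \in R.
Hypothesis right_root : A0 + K \in R.
Hypothesis K0 : K = 0 -> 1 < N.
Hypothesis K1 : K <= 1 -> g = 0.
Hypothesis F_par : 1 < K -> forall r, r \in Fb ++ Ft -> P r.
Hypothesis G_par : 1 < K -> forall r, r \in Gs -> ~~ P r.
Hypothesis Ft_le1 : size Ft <= 1.
Hypothesis Ft_gap : 1 < K -> 0 < size Ft -> ~~ odd g && (s0 + g < wN).
Hypothesis no_Ft_gap : 1 < K -> odd g -> wN < s0 + g.
Hypothesis R_inj : {in R &, forall r r', odd r = odd r' -> hs r = hs r' -> r = r'}.

Let BN : N + 2 <= B.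
Proof.
have : 1 * N <= L.-1 * N by rewrite leq_mul2r; move: L_gt1; clear; lia.
by rewrite /B /layer_base; move: A0_bd A1_bd; clear; lia.
Qed.

Let gN : g <= N. Proof. by rewrite /N /R size_cat leq_addr. Qed.
Let plN : pl <= N. Proof. by rewrite /pl; case: ifP. Qed.
Let prN : pr <= N. Proof. by rewrite /pr; case: ifP. Qed.

Let BE : B = layer_base N A0 A1 L.-2 + N + (L.-2 < A0) + (L.-2 < A1).
Proof.
rewrite /B; have -> : L.-1 = L.-2.+1 by move: L_gt1; clear; lia.
by rewrite layer_baseS /= !addnA.
Qed.

Let YB : Y + N <= B + 1.
Proof. by rewrite BE /Y; clear; lia. Qed.

Let alpha_ge : ~~ long -> N < alpha.
Proof.
rewrite /alpha /low_label /= /pl => ->; case: eqP => [->|ne] /=; first by clear; lia.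
have : 1 * N <= A0.-1 * N by rewrite leq_mul2r; move: ne A0_bd; clear; lia.
by rewrite /layer_base; clear; lia.
Qed.

Let alpha'_ge : N < alpha'.
Proof.
rewrite /alpha' /low_label /= /pr; case: eqP => [->|ne] /=; first by clear; lia.
have : 1 * N <= A1.-1 * N by rewrite leq_mul2r; move: ne A1_bd; clear; lia.
by rewrite /layer_base; clear; lia.
Qed.

Let alpha_long : long -> alpha < Y /\ layer_base N A0 A1 L.-2 < alpha.
Proof.
move=> l; have A0E := left_long l; rewrite /alpha /low_label /= /Y A0E.
have -> : L.-2 < L.-1 by move: L_gt1; clear; lia.
by rewrite /pl l /= /pr; clear; case: (A1 == 1) => /=; lia.
Qed.

Let y c : c < N -> low_label N A0 A1 pl pr (Leg c) L.-2 = Y + c.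
Proof.
move=> cN; rewrite /low_label /= /Y.
have -> : (pl <= c) = (pl == 0) by rewrite /pl; case: ifP => _; move: cN; clear; lia.
have -> : (pr <= c) = (pr == 0) by rewrite /pr; case: ifP => _; move: cN; clear; lia.
by clear; lia.
Qed.

Let wE c : c < N -> top_sum L R A0 A1 pl pr x c = W + Y + 2 * c + (g <= c).
Proof. by move=> cN; rewrite /top_sum -/N y // /x; clear; lia. Qed.

Let nbK : nb + ext = K.
Proof. by rewrite /nb /ext; clear; case: long => /=; lia. Qed.

Let ext_K : ext -> ~~ odd K && (0 < K). Proof. by case/andP. Qed.

Let fP i : A0 < i <= A0 + K ->
  [|| (i == A0 + K) && (f i == W + g),
      [&& ext, i == A0.+1, i < A0 + K & f i == m],
      [&& i < A0 + K, ext ==> (A0.+1 < i), odd (A0 + K - i)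
        & f i + (A0 + K - i)./2 == B + nb./2]
    | [&& i < A0 + K, ext ==> (A0.+1 < i), ~~ odd (A0 + K - i)
        & f i + (A0 + K - i)./2 == W]].
Proof.
move=> i_bd; rewrite /f /end_label /W.
move: nbK i_bd; clear; move: ext nb m g => e b M G be i_bd.
have [d0|d0] := eqVneq (A0 + K - i) 0; first by lia.
case: e be => /= be; last by case: ifP; lia.
by have [->|ne] := eqVneq i A0.+1; [lia | case: ifP; lia].
Qed.

Let f_bd i : A0 < i <= A0 + K -> B < f i <= m.
Proof.
move=> i_bd; have := fP i_bd; move: i_bd nbK ext_K gN; rewrite /W /m; clear.
by move: ext nb (f i) => e b fi; case: e => /=; lia.
Qed.

Let extE : ext = [&& ~~ long, ~~ odd K & 0 < K]. Proof. by []. Qed.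

Let f_inj i j : A0 < i <= A0 + K -> A0 < j <= A0 + K -> f i = f j -> i = j.
Proof.
move=> i_bd j_bd; have := fP i_bd; have := fP j_bd.
move: i_bd j_bd nbK ext_K gN; rewrite /W /m; clear.
by move: ext nb (f i) (f j) => e b fi fj; case: e => /=; lia.
Qed.

Let f_x i c : A0 < i <= A0 + K -> c < N -> f i <> x c.
Proof.
move=> i_bd cN; have := fP i_bd; rewrite /x.
move: i_bd cN nbK ext_K; rewrite /W /m; clear.
by move: ext nb (f i) => e b fi; case: e => /=; lia.
Qed.

Let nb_gt0 : 0 < K -> 0 < nb.
Proof. by move: nbK ext_K; clear; case: ext => /=; lia. Qed.

Let x_bd c : c < N -> B < x c <= m.
Proof.
move=> cN; rewrite /x /m /W; move: cN gN nbK nb_gt0 K1; clear; case: ext => /=; lia.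
Qed.

Let f_last : 0 < K -> f (A0 + K) = W + g.
Proof. by rewrite /f /end_label subnn. Qed.

(** The sums are consecutive integers leading up to [s0], except that the gap label adds [g] to the
    last one and that [ext] makes the first one larger than the rest. *)
Let sP i : A0 < i < A0 + K ->
  [|| [&& i.+1 == A0 + K, ext ==> (A0.+1 < i) & f i + f i.+1 == s0 + g],
      [&& i.+1 < A0 + K, ext ==> (A0.+1 < i) & f i + f i.+1 + (A0 + K - i.+1) == s0]
    | [&& ext, i == A0.+1 & (K == 2) && (f i + f i.+1 == s0 + N + 2 + g)
        || (2 < K) && (f i + f i.+1 == s0 + N + 2)]].
Proof.
move=> i_bd; have iA : A0 < i by case/andP: i_bd.
have mid j d : A0 < j -> j + d.+1 = A0 + K -> ext ==> (A0.+1 < j) ->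
    f j + d.+1./2 = if odd d then W else B + nb./2.
  move=> jA jd e1; have j_bd : A0 < j <= A0 + K by move: jA jd; clear; lia.
  have := fP j_bd; have -> : A0 + K - j = d.+1 by move: jd; clear; lia.
  move: e1 jd; clear; move: ext (f j) => e fj e1 jd; rewrite /=.
  by case: (odd d) => /=; case: e e1 => /=; lia.
have [iK|iK] := eqVneq i.+1 (A0 + K).
  rewrite iK f_last; last by move: i_bd; clear; lia.
  have [e1|ne] := boolP (ext ==> (A0.+1 < i)).
    have := mid i 0 iA; rewrite addn1 => /(_ iK e1) /=; rewrite addn0 => ->.
    by apply/orP; left; rewrite /s0 /W; clear; lia.
  have [e iA1] : ext /\ i = A0.+1 by move: ne iA; clear; case: ext => /=; lia.
  have -> : f i = m.
    by rewrite /f /end_label e iA1 eqxx; case: eqP => //; move: iK; rewrite iA1; clear; lia.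
  have K2 : K = 2 by move: iK; rewrite iA1; clear; lia.
  apply/orP; right; apply/orP; right; rewrite e iA1 K2 !eqxx /= orbF.
  by move: nbK; rewrite e K2 /s0 /W /m K2; clear; lia.
pose d := A0 + K - i.+2.
have id2 : i + d.+2 = A0 + K by rewrite /d; move: i_bd iK; clear; lia.
have f2 : f i.+1 + d.+1./2 = if odd d then W else B + nb./2.
  apply: mid; [exact: ltnW | by rewrite addSnnS | by rewrite ltnS iA implybT].
have [e1|ne] := boolP (ext ==> (A0.+1 < i)).
  have := mid i d.+1 iA id2 e1 => f1.
  apply/orP; right; apply/orP; left; apply/and3P; split=> //.
    by move: id2; clear; lia.
  have -> : A0 + K - i.+1 = d.+1 by move: id2; clear; lia.
  move: f1 f2; rewrite /s0 /W /=; clear; move: (f i) (f i.+1) d => u v d.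
  by case dE: (odd d) => /=; move: dE; lia.
have [e iA1] : ext /\ i = A0.+1 by move: ne iA; clear; case: ext => /=; lia.
have fm : f i = m.
  rewrite /f /end_label e iA1 eqxx; case: eqP => //; move: id2; rewrite iA1; clear; lia.
have dE : K = d.+3 by move: id2; rewrite iA1; clear; lia.
have dodd : odd d by have := ext_K e; rewrite dE /=; clear; lia.
apply/orP; right; apply/orP; right; rewrite e iA1 eqxx /=; apply/orP; right.
rewrite -iA1 fm; have := nbK; rewrite e; move: f2; rewrite dodd /s0 /m /W dE.
by clear; move: (f i.+1) nb => v b; lia.
Qed.

Let nA : n - A1 = A0 + K. Proof. by rewrite nE addnK. Qed.

Let hsE i : hs i = (if i == A0 then alpha else f i)
  + (if i == A0 + K then alpha' else f i.+1) + rsum R x i.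
Proof. by rewrite /hs /high_sum nA. Qed.

Let f_first : 0 < K ->
  if ext then f A0.+1 = m
  else B < f A0.+1 <= B + uphalf K /\ (odd K -> f A0.+1 = B + uphalf K).
Proof.
move=> K_gt0; have bd : A0 < A0.+1 <= A0 + K by move: K_gt0; clear; lia.
have := fP bd; have := f_bd bd; move: K1 nbK ext_K; rewrite /W /m; clear.
by move: ext nb (f _) => e b fi; case: e => /=; lia.
Qed.

Let nonrootP i : A0 <= i <= A0 + K -> i \notin R ->
  [|| [&& long, i == A0, 0 < K & alpha + B < hs i <= alpha + B + uphalf K],
      [&& A0 < i, i.+1 == A0 + K, ext ==> (A0.+1 < i) & hs i == s0 + g],
      [&& A0 < i, i.+1 < A0 + K, ext ==> (A0.+1 < i) & hs i + (A0 + K - i.+1) == s0]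
    | [&& ext, i == A0.+1, 2 <= K & s0 + N + 2 <= hs i <= s0 + N + 2 + (K == 2) * g]].
Proof.
move=> i_bd iR; rewrite hsE rsum_notin // addn0.
have -> : i == A0 + K = false by apply: contraNF iR => /eqP->.
have [iA|iA] := eqVneq i A0.
  have ln : long by apply: contraNT iR; rewrite iA; apply: left_root.
  have K_gt0 : 0 < K.
    by rewrite lt0n; apply: contraNneq iR => KE; rewrite iA -[A0]addn0 -KE.
  have := f_first K_gt0; rewrite iA extE ln /= => -[f1 _]; apply/orP; left.
  by rewrite K_gt0; move: f1; clear; lia.
have iK : i != A0 + K by apply: contraNneq iR => ->.
have i_bd' : A0 < i < A0 + K by move: i_bd iA iK; clear; lia.
have := sP i_bd'; move: i_bd' iA; clear.
by move: ext long (f i) (f i.+1) => e l fi fi'; case: e; case: l => /=; lia.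
Qed.

Let rootP i : 0 < K -> i \in R ->
  [|| [&& ~~ long, i == A0, ~~ ext, odd K & N + B + uphalf K + W < hs i],
      [&& ~~ long, i == A0, ext & N + m + W < hs i],
      (i == A0 + K) && (N + W + g + W < hs i)
    | [&& A0 < i, i < A0 + K, 2 * B + 1 + W < hs i & s0 + W + 1 < hs i + K]].
Proof.
move=> K_gt0 iR; have := R_bd iR; have iN : index i R < size R by rewrite index_mem.
have := rsum_ge x iN; rewrite nth_index // hsE => xr i_bd.
have {}xr : W <= rsum R x i.
  by apply: leq_trans xr; rewrite /x -addnA leq_addr.
move: (rsum R x i) xr => r xr.
have [iA|iA] := eqVneq i A0.
  have ln : ~~ long by apply/negP => ln; move: i_bd; rewrite iA ln; clear; lia.
  have -> : i == A0 + K = false by rewrite iA; move: K_gt0; clear; lia.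
  have al := alpha_ge ln; have := f_first K_gt0; rewrite iA ln /=.
  have [e|ne] := boolP ext => /=; first by move=> ->; move: xr al; clear; lia.
  have oK : odd K by move: ne; rewrite extE ln K_gt0 andbT /= negbK.
  by rewrite oK => -[_ ->] //; move: xr al; clear; lia.
have [iK|iK] := eqVneq i (A0 + K).
  rewrite iK f_last //; move: xr alpha'_ge; clear; lia.
have i_bd' : A0 < i < A0 + K by move: i_bd iA iK; clear; lia.
have /f_bd/andP[f1 _] : A0 < i <= A0 + K by move: i_bd'; clear; lia.
have /f_bd/andP[f2 _] : A0 < i.+1 <= A0 + K by move: i_bd'; clear; lia.
have := sP i_bd'; move: i_bd' iA xr f1 f2; clear.
by move: ext long (f i) (f i.+1) => e l fi fi'; case: e; case: l => /=; lia.
Qed.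

Let mE : n + N * L = m.
Proof.
have h0 : minn L.-1 A0 = A0 by move: A0_bd; clear; lia.
have h1 : minn L.-1 A1 = A1 by move: A1_bd; clear; lia.
rewrite /m /B /layer_base h0 h1 nE mulnC -[in LHS](prednK (ltnW L_gt1)) mulSn.
by clear; lia.
Qed.

(** All legs hang at the same vertex; the first and the last of them have top labels [B + 1] and
    [B + N]. *)
Let rsum0 : K = 0 -> 2 * B + 1 + N <= rsum R x A0.
Proof.
move=> KE; have g0 : g = 0 by apply: K1; rewrite KE.
have all_root c : c < N -> nth 0 R c = A0.
  move=> cN; have : nth 0 R c \in R by apply: mem_nth.
  by move: (nth 0 R c) => r /R_bd; rewrite KE; clear; lia.
have N1 := K0 KE; have W0 : W = B by rewrite /W /nb KE sub0n addn0.
have l1 : 0 < size R by move: N1; clear; lia.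
have l2 : N.-1 < size R by rewrite prednK.
rewrite /rsum (bigD1 (Ordinal l1)) /=; last by rewrite all_root.
rewrite (bigD1 (Ordinal l2)) /=; last first.
  by rewrite all_root ?eqxx //= -val_eqE /=; move: N1; clear; lia.
by rewrite /x g0 W0; move: N1; clear; lia.
Qed.

Let high_gt0 i : A0 <= i <= A0 + K -> B + layer_base N A0 A1 L.-2 < hs i.
Proof.
move=> i_bd; have lB : layer_base N A0 A1 L.-2 + N <= B by rewrite BE; clear; lia.
have [KE|K_gt0] := posnP K.
  have -> : i = A0 by move: i_bd; rewrite KE; clear; lia.
  by rewrite hsE; have := rsum0 KE; move: lB; clear; lia.
have nbB : B <= W by rewrite leq_addr.
have [iR|iR] := boolP (i \in R).
  have := rootP K_gt0 iR; move: lB nbB N_gt0 BN; rewrite /m /s0 /W; clear.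
  by move=> ? ? ? ? /or4P[] h; lia.
have := nonrootP i_bd iR; case/or4P.
- case/and4P=> l _ _; have [_] := alpha_long l; clear; lia.
- by case/and4P=> _ _ _ /eqP->; move: lB N_gt0; rewrite /s0; clear; lia.
- move: i_bd lB N_gt0 nbK; rewrite /s0; case: ext; clear; lia.
- by move: lB; rewrite /s0; clear; lia.
Qed.

Let upK : 0 < K -> K <= nb + 1 /\ uphalf K <= nb.
Proof. by have := ext_K; move: nbK; clear; case: ext => /=; lia. Qed.

Let alpha_B : long -> alpha + N <= B.
Proof. by case/alpha_long => + _; move: YB; clear; lia. Qed.

(** Equal parity is assumed because for [K = 2] under [ext] the bounds do not separate the root
    [A0 + 2] from the vertex [A0 + 1]. *)
Let root_nonroot i j : 0 < K -> i \in R -> A0 <= j <= A0 + K -> j \notin R ->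
  odd i = odd j -> hs j < hs i.
Proof.
move=> K_gt0 iR j_bd jR par; have ij : i != j by apply: contraNneq jR => <-.
have rP := rootP K_gt0 iR; have nP := nonrootP j_bd jR.
have [nb1 nb2] := upK K_gt0.
move: ij par BN gN nbK ext_K alpha_B rP nP; rewrite /m /s0 /W; clear.
move: (hs i) (hs j) => u v ij par BN gN nbK eK aB.
move: ext nb long nbK eK aB => e b l be eK aB.
move=> /or4P[] h1 /or4P[] h2; case: e be eK h1 h2 => /= be eK h1 h2.
all: case: l aB h1 h2 => /= aB h1 h2 //.
all: split_andb; lia.
Qed.

Let nonroot_inj i j : A0 <= i <= A0 + K -> A0 <= j <= A0 + K ->
  i \notin R -> j \notin R -> hs i = hs j -> i = j.
Proof.
move=> i_bd j_bd iR jR; have iP := nonrootP i_bd iR; have jP := nonrootP j_bd jR.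
move: N_gt0 gN nbK alpha_B iP jP i_bd j_bd; rewrite /s0; clear.
move: (hs i) (hs j) ext nb long => u v e b l N0 gN be aB.
move=> /or4P[] h1 /or4P[] h2 i_bd j_bd uv; case: e be h1 h2 => /= be h1 h2 //.
all: case: l aB h1 h2 => /= aB h1 h2 //.
all: try have {}aB := aB isT.
all: split_andb; lia.
Qed.

Let wN_ge c : c < N -> W + Y + 2 * c + (g <= c) <= wN.
Proof. by rewrite /wN; clear; lia. Qed.

Let wN_le : wN <= W + B + N.
Proof. by move: YB; rewrite /wN; clear; lia. Qed.

Let nth_R c : c < N -> [|| (c < g) && (nth 0 R c \in Fb),
  (g <= c) && (nth 0 R c \in Gs)
  | [&& g <= c, c == N.-1, size Ft == 1 & nth 0 R c \in Ft]].
Proof.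
move=> cN; rewrite /R nth_cat -/g; have [cg|gc] /= := ltnP c g; first by rewrite mem_nth.
rewrite nth_cat; have [cG|Gc] := ltnP (c - g) (size Gs); first by rewrite mem_nth.
apply/orP; right; have NE : N = g + (size Gs + size Ft) by rewrite /N /R !size_cat.
have Ft1 : size Ft = 1 by move: NE cN gc Gc Ft_le1; clear; lia.
have lt : c - g - size Gs < size Ft by move: NE cN gc Gc; clear; lia.
rewrite Ft1 eqxx (mem_nth 0 lt) !andbT.
by move: NE cN gc Gc; rewrite Ft1; clear; lia.
Qed.

(** The junction of a long arm lies below all top sums, and the sum raised by [ext] above them. The
    others are separated by parity, except that the last sum lies above all top sums if [g] is odd,
    and that a leg of [Ft] has top sum [wN], above these spine sums. *)
Let nonroot_w i c : 0 < K -> A0 <= i <= A0 + K -> i \notin R -> c < N ->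
  odd i = ~~ odd (nth 0 R c) -> hs i <> W + Y + 2 * c + (g <= c).
Proof.
move=> K_gt0 i_bd iR cN par; have [nb1 nb2] := upK K_gt0.
case/or4P: (nonrootP i_bd iR) => h.
- case/and4P: h => l _ _ /andP[_ hu]; have [aY _] := alpha_long l.
  by move: hu aY nb2; rewrite /W; clear; lia.
- case/and4P: h => iA iK e1 /eqP->; have KK : 1 < K by move: iA iK; clear; lia.
  have cw := wN_ge cN.
  have [og|eg] := boolP (odd g); first by have := no_Ft_gap KK og; move: cw; clear; lia.
  case/or3P: (nth_R cN) => [/andP[cg rF]|/andP[gc rG]|/and4P[gc /eqP cE Ft1 _]].
  + have := @F_par KK (nth 0 R c); rewrite mem_cat rF => /(_ isT).
    by move: par iK eg cg; rewrite /P /s0 /W; move: (nth 0 R c); clear; lia.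
  + have := @G_par KK _ rG.
    by move: par iK eg gc; rewrite /P /s0 /W; move: (nth 0 R c); clear; lia.
  + have := Ft_gap KK; rewrite (eqP Ft1) => /(_ isT) /andP[_].
    by move: gc cE N_gt0; rewrite /wN; clear; lia.
- case/and4P: h => iA iK e1 hi; have KK : 1 < K by move: iA iK; clear; lia.
  have cw := wN_ge cN.
  case/or3P: (nth_R cN) => [/andP[cg rF]|/andP[gc rG]|/and4P[gc /eqP cE Ft1 _]].
  + have := @F_par KK (nth 0 R c); rewrite mem_cat rF => /(_ isT).
    by move: par iK hi cg; rewrite /P /s0 /W; move: (nth 0 R c) (hs i); clear; lia.
  + have := @G_par KK _ rG.
    by move: par iK hi gc; rewrite /P /s0 /W; move: (nth 0 R c) (hs i); clear; lia.
  + have := Ft_gap KK; rewrite (eqP Ft1) => /(_ isT) /andP[_].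
    by move: hi gc cE N_gt0; rewrite /wN; clear; lia.
- case/and4P: h => _ _ _ /andP[h _]; have := wN_ge cN; move: h wN_le N_gt0.
  by rewrite /s0 /W; clear; lia.
Qed.

Lemma short_arm_admits : admits_antimagic_orientation (comb n L R).
Proof.
apply: (@low_high_admits n L R A0 A1 pl pr f x) => //;
  rewrite ?nA -?/N ?mE -?/B //.
- by rewrite nE; clear; lia.
- by move=> r /R_bd; clear; lia.
- by move=> c d; rewrite /x; clear; lia.
- move=> i j i_bd j_bd par; rewrite -/hs.
  have [KE|K_gt0] := posnP K.
    by move: i_bd j_bd; rewrite KE; clear; lia.
  have [iR|iR] := boolP (i \in R); have [jR|jR] := boolP (j \in R).
  + exact: R_inj.
  + by have := root_nonroot K_gt0 iR j_bd jR par; clear; lia.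
  + by have := root_nonroot K_gt0 jR i_bd iR (esym par); clear; lia.
  + exact: nonroot_inj.
- move=> i c i_bd cN par; rewrite -/hs wE //.
  have cw := wN_ge cN.
  have [KE|K_gt0] := posnP K.
    have -> : i = A0 by move: i_bd; rewrite KE; clear; lia.
    have W0 : W = B by rewrite /W /nb KE sub0n addn0.
    by rewrite hsE; have := rsum0 KE; move: cw wN_le; rewrite W0; clear; lia.
  have [iR|iR] := boolP (i \in R); last exact: nonroot_w.
  have := rootP K_gt0 iR; move: cw wN_le BN; rewrite /m /W; clear => cw wNl BN.
  by case/or4P=> h; split_andb; lia.
Qed.

End ShortArm.

(** The labels available to the legs of the first parity class: a moved leg is the very last one and
    takes the label of index [N.-1]. *)
Lemma moved_label_lt W g f N : g <= f <= g.+1 -> f <= N ->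
  let x c := W + c + (g <= c) in
  let xF c := if c < g then x c else x N.-1 in
  forall i j, i < j < f -> xF i < xF j.
Proof. move=> ? ? x xF i j ij; rewrite /xF /x; case: (ltnP i g); case: (ltnP j g); lia. Qed.

Lemma shifted_label_lt W g i j : i < j ->
  W + (g + i) + (g <= g + i) < W + (g + j) + (g <= g + j).
Proof. by lia. Qed.

(** Only the first [L.-1] edges of a long left arm count as the arm; a short arm ends at the extreme
    root. The last hypothesis excludes a single leg longer than both arms. *)
Lemma comb_short_right n L (R : seq nat) a b : 1 < L ->
  a \in R -> b \in R -> (forall r, r \in R -> a <= r <= b) ->
  0 < a -> b < n -> n - b < L ->
  [|| L <= a, a < b | 1 < size R] ->
  admits_antimagic_orientation (comb n L R).
Proof.
move=> L1 aR bR R_bd a0 bn bL ndeg.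
have gapT u s w : odd u -> s + u <= w -> ~~ odd (u - true) && (s + (u - true) < w).
  by clear; lia.
have lastE u g N G c : c < u - g -> u <= g.+1 -> N = g + G + (u - g) -> N.-1 = g + (G + c).
  by clear; lia.
pose long := L <= a; pose A0 := minn a L.-1; pose A1 := n - b; pose K := n - A0 - A1.
pose N := size R.
pose ext := [&& ~~ long, ~~ odd K & 0 < K]; pose nb := K - ext.
pose pl := if ~~ long && (A0 == 1) then N else 0; pose pr := if A1 == 1 then N else 0.
pose B := layer_base N A0 A1 L.-1.
pose Y := (layer_base N A0 A1 L.-2
  + ((L.-2 < A0) && (pl == 0)) + ((L.-2 < A1) && (pr == 0))).+1.
pose W := B + nb; pose m := B + K + N.
pose s0 := 2 * B + nb + nb./2; pose wN := W + Y + 2 * N - 1.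
pose P r := odd (nb + nb./2 + r + A0 + K + W + Y).
pose Q r := (1 < K) && P r.
(* One leg of the class is moved behind exactly if [fc] is odd and the sum [s0 + fc] is within reach
   of the top sums. [Q] includes [1 < K] so that no leg precedes the gap for smaller [K]. *)
pose fc := count Q R; pose g := fc - (odd fc && (s0 + fc <= wN)).
pose f := end_label A0 K B nb g m ext.
pose x c := W + c + (g <= c).
pose base i := (if i == A0 then low_label N A0 A1 pl pr LeftArm A0.-1 else f i)
  + (if i == n - A1 then low_label N A0 A1 pl pr RightArm A1.-1 else f i.+1).
have N0 : 0 < N by rewrite /N; case: (R) aR.
have fcN : fc <= N by apply: count_size.
have g_fc : g <= fc <= g.+1.
  have sub u (c : bool) : u - c <= u <= (u - c).+1 by clear; case: c; lia.
  exact: sub.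
have [Fs [Fperm F_inj _]] := @exists_injective_order
  (fun c => if c < g then x c else x N.-1) base [seq r <- R | Q r]
  ltac:(rewrite size_filter; exact: moved_label_lt g_fc fcN).
have [Gs [Gperm G_inj _]] := @exists_injective_order (fun c => x (g + c)) base
  [seq r <- R | ~~ Q r] (fun i j ij => shifted_label_lt W g (proj1 (andP ij))).
have szF : size Fs = fc by rewrite -(perm_size Fperm) size_filter.
have FP r : (r \in Fs) = (r \in R) && Q r by rewrite -(perm_mem Fperm) mem_filter andbC.
have GP r : (r \in Gs) = (r \in R) && ~~ Q r by rewrite -(perm_mem Gperm) mem_filter andbC.
pose Fb := take g Fs; pose Ft := drop g Fs.
have FE : Fs = Fb ++ Ft by rewrite cat_take_drop.
have szFb : size Fb = g by rewrite size_takel // szF; case/andP: g_fc.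
have szFt : size Ft = fc - g by rewrite size_drop szF.
have permR : perm_eq R (Fb ++ Gs ++ Ft).
  rewrite perm_sym perm_catCA perm_sym -(perm_filterC Q R) perm_catC.
  by apply: perm_cat; rewrite -?FE.
apply: (iso_admits (comb_perm_iso n L permR)).
have NE : size (Fb ++ Gs ++ Ft) = N by rewrite -(perm_size permR).
have NE' : N = g + size Gs + (fc - g) by rewrite -NE !size_cat szFb szFt addnA.
have inR r : (r \in Fb ++ Gs ++ Ft) = (r \in R) by rewrite (perm_mem permR).
have A0E : A0 = if long then L.-1 else a.
  by rewrite /A0 /long; move: L1; clear; case: ifP; lia.
have ab : a <= b by case/andP: (R_bd _ bR).
have A0b : A0 <= b by apply: leq_trans (geq_minl _ _) ab.
have bE : A0 + K = b.
  have sub u : u <= b -> u + (n - u - (n - b)) = b by move: bn; clear; lia.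
  exact: sub.
apply: (@short_arm_admits L n A0 A1 K long Fb Gs Ft); rewrite ?NE ?szFb //.
- by rewrite bE /A1 subnKC // ltnW.
- by rewrite /A0; move: L1 a0; clear; lia.
- by rewrite /A1; move: L1 bn bL; clear; lia.
- move=> r; rewrite inR => /R_bd; rewrite bE A0E /long; move: L1; clear; case: (leqP L a); lia.
- by rewrite A0E => ->.
- by rewrite inR A0E => /negbTE->.
- by rewrite inR bE.
(* [K = 0] means [A0 = b], which rules out a long left arm and gives [a = b]; so there is more than
   one leg. *)
- move=> KE; have := R_bd _ bR; move: ndeg bE L1; rewrite KE -/N A0E /long.
  by clear; case: (leqP L a); lia.
- move=> K1; rewrite /g (_ : fc = 0) //; apply/eqP; rewrite -leqn0 leqNgt -has_count.
  by apply/hasPn => r _; rewrite /Q ltnNge K1.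
- by move=> _ r; rewrite -FE FP => /andP[_ /andP[]].
- by move=> K1 r; rewrite GP /Q K1 => /andP[].
- by rewrite szFt leq_subLR addn1; case/andP: g_fc.
- move=> K1; rewrite szFt -/s0 -/wN -/g /g.
  case: (boolP (odd fc && _)) => [/andP[o le] _|_]; first exact: gapT.
  by rewrite subn0 subnn.
- move=> K1; rewrite -/wN -/s0 ltnNge /g.
  case: (boolP (odd fc && _)) => [/andP[o le]|no og].
    by case/andP: (gapT _ _ _ o le) => /negbTE->.
  rewrite subn0 in og *; apply: contra no => le; by rewrite og.
- have hsE r : high_sum n (Fb ++ Gs ++ Ft) A0 A1 pl pr f x r =
      base r + rsum (Fb ++ Gs ++ Ft) x r.
    by rewrite /high_sum NE.
  have rsG r : r \in Gs -> rsum (Fb ++ Gs ++ Ft) x r = rsum Gs (fun c => x (g + c)) r.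
    move=> rG; have rF : r \notin Fs.
      by move: rG; rewrite FP GP => /andP[_ /negbTE->]; rewrite andbF.
    move: rF; rewrite FE mem_cat negb_or => /andP[r1 r2].
    by rewrite !rsum_cat szFb (rsum_notin _ r1) (rsum_notin _ r2) addn0.
  have rsF r : r \in Fs -> rsum (Fb ++ Gs ++ Ft) x r =
      rsum Fs (fun c => if c < g then x c else x N.-1) r.
    move=> rF; have rG : r \notin Gs by move: rF; rewrite FP GP => /andP[_ ->]; rewrite andbF.
    rewrite FE !rsum_cat szFb (rsum_notin _ rG) add0n; congr (_ + _).
      by apply: eq_rsum => c; rewrite szFb => ->.
    apply: eq_rsum => c; rewrite szFt => c_lt; rewrite ifN -?leqNgt ?leq_addr //.
    by congr x; apply/esym; apply: lastE c_lt _ NE'; case/andP: g_fc.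
  move=> r r'; rewrite !inR => rR r'R par; rewrite -/pl -/pr -/f -/x !hsE.
  have FG r1 : r1 \in R -> (r1 \in Fs) || (r1 \in Gs).
    by move=> h; rewrite FP GP h /=; case: (Q r1).
  (* Roots of equal parity fall into the same class, within which the order of the legs keeps the
     sums apart. *)
  have sameP : Q r = Q r'.
    by rewrite /Q /P !oddD par.
  have := FG r rR; rewrite FP GP rR /=; case Qr: (Q r) => /= _.
    have rF : r \in Fs by rewrite FP rR.
    have r'F : r' \in Fs by rewrite FP r'R -sameP.
    by rewrite !rsF //; apply: F_inj; rewrite (perm_mem Fperm).
  have rG : r \in Gs by rewrite GP rR Qr.
  have r'G : r' \in Gs by rewrite GP r'R -sameP Qr.
  by rewrite !rsG //; apply: G_inj; rewrite (perm_mem Gperm).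
Qed.

(** * Legs of length one *)

Section Mixed.
Variables (n : nat) (R : seq nat) (e x : nat -> nat).
Let m := n + size R.
Hypothesis n_gt0 : 0 < n.
Hypothesis R_bd : forall r, r \in R -> 0 < r < n.
Hypothesis e_bd : forall i, 0 < i <= n -> 0 < e i <= m.
Hypothesis x_bd : forall c, c < size R -> 0 < x c <= m.
Hypothesis e_inj : forall i j, 0 < i <= n -> 0 < j <= n -> e i = e j -> i = j.
Hypothesis x_inj : forall c d, c < size R -> d < size R -> x c = x d -> c = d.
Hypothesis e_x : forall i c, 0 < i <= n -> c < size R -> e i <> x c.

(* The spine is oriented as a path that reverses its direction at the vertices in
   [turn], where both spine edges enter or both leave. *)
Variable turn : pred nat.
Hypothesis R_turn : forall r, r \in R -> turn r.

Definition abs_sum i : nat :=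
  if i == 0 then e 1 else if i == n then e n
  else if turn i then e i + e i.+1 + rsum R x i
  else maxn (e i) (e i.+1) - minn (e i) (e i.+1).

Hypothesis abs_sum_inj : forall i j, i <= n -> j <= n -> abs_sum i = abs_sum j -> i = j.
Hypothesis abs_sum_x : forall i c, i <= n -> c < size R -> abs_sum i <> x c.

(** The parity of the number of turns before v_i, which determines the direction of the edge between
    v_(i-1) and v_i. *)
Fixpoint turned i : bool := if i is j.+1 then turned j (+) turn j else false.

Let ls (c l : nat) := ~~ turned (nth 0 R c).

(** Leg edges enter or leave a root together with its spine edges, so labels add up there; at
    vertices that are traversed they subtract. Distinct absolute values suffice. *)
Lemma mixed_admits : admits_antimagic_orientation (comb n 1 R).
Proof.
have absE i : i <= n -> absz (spine_val n 1 R e (fun c _ => x c) turned ls i) = abs_sum i.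
  move=> i_le; rewrite /spine_val /abs_sum.
  have -> : (\sum_(c < size R | nth 0 R c == i) dir (ls c 1.-1) (x c)
     = dir (~~ turned i) (rsum R x i))%R.
    rewrite (eq_bigr (fun c : 'I_(size R) => dir (~~ turned i) (x c))); last first.
      by move=> c /eqP ci; rewrite /ls ci.
    rewrite /rsum (big_morph (dir (~~ turned i)) (id1 := 0%R) (op1 := +%R)) //.
    - by move=> u v; rewrite /dir; case: (~~ _) => /=; lia.
    - by rewrite /dir; case: (~~ _).
  have [i0|i_gt0] := posnP i.
    rewrite i0 n_gt0 rsum_notin; last by apply/negP => /R_bd.
    by rewrite /dir; case: (turned _); case: (turned _) => /=; lia.
  have [->|i_n] := eqVneq i n.
    rewrite ltnn rsum_notin; last by apply/negP => /R_bd; rewrite ltnn andbF.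
    by rewrite /dir; case: (turned _) => /=; lia.
  have -> : i < n by lia.
  rewrite /=; case: ifP => ti.
    by rewrite addbT /dir; case: (turned i) => /=; lia.
  rewrite rsum_notin; last by apply/negP => /R_turn; rewrite ti.
  by rewrite addbF /dir; case: (turned i) => /=; lia.
have legE c l : c < size R -> l < 1 -> absz (leg_val (fun c _ => x c) ls c l) = x c.
  by move=> _; case: l => //= _; rewrite /leg_val /dir; case: (ls c 0) => /=; lia.
apply: (@comb_admits n 1 R _ _ _ e (fun c _ => x c) _ _ _ _ _ turned ls); rewrite ?muln1 //.
- by apply/allP => r /R_bd; lia.
- by move=> c l; move=> cR _; apply: x_bd.
- by move=> c [|//] d [|//] cR _ dR _ /x_inj-> //.
- by move=> i c l i_bd cR _; apply: e_x.
- by move=> i j i_le j_le /(congr1 absz); rewrite !absE //; apply: abs_sum_inj.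
- move=> c [|//] d [|//] cR _ dR _ /(congr1 absz); rewrite !legE //.
  by move=> /x_inj->.
- by move=> i c l i_le cR l0 /(congr1 absz); rewrite absE // legE //; apply: abs_sum_x.
Qed.

End Mixed.

(** From [i = 1] on: K, 1, K - 1, 2, ..., with successive differences K - 1, K - 2, and so on. *)
Definition zigzag K i := if odd i then K - i./2 else i./2.

Section OneEdgeLegs.
Variables (n : nat) (R0 : seq nat).
Hypothesis n_gt1 : 1 < n.
Hypothesis R0_bd : forall r, r \in R0 -> 0 < r < n.
Hypothesis R0_ends : (n.-1 \in R0) || (1 \notin R0).
Let N := size R0.
Let K := n.-1.
(** The label of the last spine edge. If v_(n-1) has no leg, its sum [uphalf K + t] has to exceed
    every label. *)
Let t := if n.-1 \in R0 then n else maxn n (n + N + 1 - uphalf K).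
Let e i := if i < n then zigzag K i else t.
Let x c := n + c + (t <= n + c).
Let turn i := (i \in R0) || (i == n.-1).

Let t_bd : n <= t <= n + N.
Proof. by rewrite /t; case: ifP => _; move: n_gt1; rewrite /K; clear; lia. Qed.

Let e_n : e n = t. Proof. by rewrite /e ltnn. Qed.

Let e_lt i : 0 < i < n -> 0 < e i < n.
Proof.
move=> i_bd; rewrite /e /zigzag /K; have -> : i < n by lia.
by case: ifP; lia.
Qed.

Let e_diff i : 0 < i -> i.+1 < n -> maxn (e i) (e i.+1) - minn (e i) (e i.+1) + i = K.
Proof.
move=> i0 i1; rewrite /e i1 (ltnW i1) /zigzag /K /=.
by case iE: (odd i) => /=; lia.
Qed.

Let e_sum i : 0 < i -> i.+1 < n -> e i + e i.+1 = K + odd i.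
Proof.
move=> i0 i1; rewrite /e i1 (ltnW i1) /zigzag /K /=.
by case iE: (odd i) => /=; lia.
Qed.

Let e_last : e n.-1 = uphalf K.
Proof.
rewrite /e /zigzag; have -> : n.-1 < n by lia.
by rewrite -/K; case: ifP; lia.
Qed.

Let roots_card a : {subset R0 <= [pred r | a <= r]} -> size (undup R0) <= n - a.
Proof.
move=> sub; rewrite -(size_iota a (n - a)); apply: uniq_leq_size; first exact: undup_uniq.
move=> r; rewrite mem_undup mem_iota => rR.
by have := sub r rR; have := R0_bd rR; rewrite inE; lia.
Qed.

(** The absolute sums lie in separate ranges: 1 to n - 2 at traversed vertices, n - 1 at v_0, n to n
    + N at v_n and the leaves of the legs, then v_(n-1) if it has no leg, and finally the roots. *)
Lemma comb_caterpillar_ends : admits_antimagic_orientation (comb n 1 R0).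
Proof.
have [R [permR S_inj S_top]] := @exists_injective_order x (fun i => e i + e i.+1) R0
  ltac:(rewrite /x; clear; lia).
apply: (iso_admits (comb_perm_iso n 1 permR)).
have NE : size R = N by rewrite -(perm_size permR).
have inR r : (r \in R) = (r \in R0) by rewrite (perm_mem permR).
have tb := t_bd.
(* The reserved leg of a root is among the last [size (undup R0)] ones. There are at most n - 1
   roots, and at most n - 3 if v_(n-1) has no leg, since v_1 has none either; so the reserved label
   is large. *)
have S_big r : r \in R0 -> n + N < e r + e r.+1 + rsum R x r /\
    (n.-1 \notin R0 -> e n.-1 + t < e r + e r.+1 + rsum R x r).
  move=> rR; have [c /andP[c_ge cN] cE] := S_top r rR; rewrite -/N in c_ge cN.
  have := @rsum_ge R x c; rewrite NE cE => /(_ cN) xr.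
  have r_bd := R0_bd rR.
  have [nR|nR] := boolP (n.-1 \in R0).
    have tE : t = n by rewrite /t nR.
    have Nn : size (undup R0) <= n - 1 by apply: roots_card => u /R0_bd; rewrite inE; lia.
    have [rn|rn] := eqVneq r n.-1.
      split=> //; rewrite rn prednK ?e_n; last lia.
      rewrite -rn; have := e_lt r_bd; move: xr c_ge cN Nn; rewrite /x tE; clear; lia.
    split=> //; rewrite e_sum; try lia.
    by move: xr c_ge cN Nn n_gt1; rewrite /x tE /K; clear; lia.
  have r2 : 1 < r < n.-1.
    have r1 : r != 1 by apply: contraTneq rR => ->; move: R0_ends; rewrite (negbTE nR).
    have r3 : r != n.-1 by apply: contraTneq rR => ->.
    by move: r_bd r1 r3; clear; lia.
  have Nn : (size (undup R0)).+1 <= n - 2.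
    have sub : {subset n.-1 :: undup R0 <= iota 2 (n - 2)}.
      move=> u; rewrite inE mem_undup mem_iota.
      move=> /predU1P[->|uR]; first by move: r2; clear; lia.
      have u1 : u != 1 by apply: contraTneq uR => ->; move: R0_ends; rewrite (negbTE nR).
      by have := R0_bd uR; move: u1; clear; lia.
    have := uniq_leq_size _ sub; rewrite size_iota /= mem_undup nR undup_uniq.
    by move=> /(_ isT).
  rewrite e_sum; try lia; rewrite e_last.
  have tE : t = maxn n (n + N + 1 - uphalf K) by rewrite /t (negbTE nR).
  have uK : uphalf K <= K by clear; lia.
  split=> [|_]; first by move: xr c_ge cN Nn n_gt1; rewrite /x /K; clear; lia.
  move: xr c_ge cN Nn n_gt1 uK tE tb; rewrite /x /K; clear.
  by case: (leqP t (n + c)) => /=; lia.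
have D_last : n.-1 \notin R0 -> n + N < e n.-1 + t.
  by move=> nR; rewrite e_last /t (negbTE nR); clear; lia.
have xb c : c < N -> n <= x c <= n + N by move=> cN; move: tb cN; rewrite /x; clear; lia.
pose a i := abs_sum n R e x turn i.
have aR i : i \in R0 -> a i = e i + e i.+1 + rsum R x i.
  move=> iR; have /andP[i0 iN] := R0_bd iR; rewrite /a /abs_sum /turn iR.
  by rewrite (gtn_eqF i0) (ltn_eqF iN).
have aN i : i <= n -> i \notin R0 ->
  [|| (i == 0) && (a i == n.-1), (i == n) && (a i == t),
      (0 < i < n.-1) && (a i + i == n.-1)
    | (i == n.-1) && (a i == e n.-1 + t)].
  move=> i_le iR; rewrite /a /abs_sum; have [->|i0] := eqVneq i 0.
    by rewrite /e n_gt1 /zigzag /= subn0 eqxx.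
  have [->|iN] := eqVneq i n; first by rewrite e_n eqxx.
  rewrite /turn (negbTE iR) /=.
  have [iK|iK] := eqVneq i n.-1.
    have eE : e i.+1 = t by rewrite iK prednK ?e_n // ltnW.
    by rewrite eE rsum_notin ?inR // addn0 -iK eqxx !orbT.
  have h1 : 0 < i by lia.
  have h2 : i.+1 < n by move: i_le iN iK; clear; lia.
  have := e_diff h1 h2; rewrite /K orbF => d.
  apply/andP; split; last by rewrite d.
  by move: h1 h2 iK; clear; lia.
have RN i j : i \in R0 -> j <= n -> j \notin R0 -> a j < a i.
  move=> iR j_le jR; have [b1 b2] := S_big i iR; rewrite (aR i iR).
  case/or4P: (aN j j_le jR) => /andP[h1 /eqP h2].
  - by rewrite h2; move: b1; clear; lia.
  - by rewrite h2; move: b1 tb; clear; lia.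
  - by move: b1 h2; clear; lia.
  - by rewrite h2 b2 // -(eqP h1).
apply: (@mixed_admits n R e x _ _ _ _ _ _ _ turn); rewrite ?NE //.
- exact: ltnW.
- by move=> r; rewrite inR; apply: R0_bd.
- move=> i i_bd; have [->|iN] := eqVneq i n; first by rewrite e_n; move: tb n_gt1; clear; lia.
  have /e_lt : 0 < i < n by move: i_bd iN; clear; lia.
  by clear; lia.
- by move=> c /xb; move: n_gt1; clear; lia.
- move=> i j i_bd j_bd; have [->|iN] := eqVneq i n; have [->|jN] := eqVneq j n => //.
  + have /e_lt : 0 < j < n by move: j_bd jN; clear; lia.
    by rewrite e_n; move: tb; clear; lia.
  + have /e_lt : 0 < i < n by move: i_bd iN; clear; lia.
    by rewrite e_n; move: tb; clear; lia.
  + rewrite /e /zigzag; have -> : i < n by move: i_bd iN; clear; lia.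
    have -> : j < n by move: j_bd jN; clear; lia.
    move: i_bd j_bd iN jN; rewrite /K; clear.
    by case iO: (odd i); case jO: (odd j); lia.
- by move=> c d _ _; rewrite /x; clear; lia.
- move=> i c i_bd cN; have [->|iN] := eqVneq i n.
    by rewrite e_n /x; clear; lia.
  have /e_lt : 0 < i < n by move: i_bd iN; clear; lia.
  by have := xb c cN; clear; lia.
- by move=> r; rewrite inR /turn => ->.
- move=> i j i_le j_le; rewrite -/(a i) -/(a j) => aij.
  have [iR|iR] := boolP (i \in R0); have [jR|jR] := boolP (j \in R0).
  + by apply: S_inj => //; rewrite /= -!aR.
  + by have := RN i j iR j_le jR; rewrite aij ltnn.
  + by have := RN j i jR i_le iR; rewrite aij ltnn.
  + have iP := aN i i_le iR; have jP := aN j j_le jR.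
    have dl : i == n.-1 -> n + N < e n.-1 + t by move=> /eqP iE; apply: D_last; rewrite -iE.
    have dl' : j == n.-1 -> n + N < e n.-1 + t by move=> /eqP jE; apply: D_last; rewrite -jE.
    move: iP jP dl dl' aij tb n_gt1; clear; move: (a i) (a j) (e n.-1) t => u v w t0.
    by move=> /or4P[] /andP[h1 h2] /or4P[] /andP[h3 h4] dl dl'; lia.
- move=> i c i_le cN; rewrite -/(a i); have c_bd := xb c cN.
  have [iR|iR] := boolP (i \in R0).
    by rewrite aR //; have [] := S_big i iR; move: c_bd; clear; lia.
  case/or4P: (aN i i_le iR) => /andP[h1 /eqP h2].
  - by move: h2 c_bd n_gt1; clear; lia.
  - by rewrite h2 /x; clear; lia.
  - by move: h2 c_bd h1; clear; lia.
  - by rewrite h2; have := D_last; rewrite -(eqP h1) => /(_ iR); move: c_bd; clear; lia.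
Qed.
End OneEdgeLegs.

(** If v_1 has a leg and v_(n-1) has none, reversing the spine restores the assumption on the
    ends. *)
Lemma comb_caterpillar n R : 1 < n -> (forall r, r \in R -> 0 < r < n) ->
  admits_antimagic_orientation (comb n 1 R).
Proof.
move=> n1 R_bd; have [ends|] := boolP ((n.-1 \in R) || (1 \notin R)).
  exact: comb_caterpillar_ends.
rewrite negb_or negbK => /andP[nR R1].
have R_le : all (fun r => r <= n) R by apply/allP => r /R_bd; lia.
apply: (iso_admits (comb_rev_iso 1 R_le)); apply: comb_caterpillar_ends => //.
- by move=> _ /mapP[r /R_bd r_bd ->]; lia.
- by apply/orP; left; apply/mapP; exists 1; rewrite ?subn1.
Qed.

(** * Assembly *)

Lemma comb_no_leg_iso n L : iso (comb n L [::]) (comb n 1 [::]).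
Proof.
apply: (@iso_comb (comb n L [::]) n 1 [::] (@comb_code n L [::])).
- exact: comb_code_inj.
- by case=> [i|[[]//]] /=; rewrite -ltnS ltn_ord.
- move=> [i i_le|[c l] //]; exists (inl (Ordinal (i_le : i < n.+1))); by [].
- by case=> [i|[[]//]] [j|[[]//]].
Qed.

(** With the shortest of the three paths at the root as the leg, the other two are arms at least as
    long as it. *)
Lemma comb_three_legs n L a : 0 < a -> a < L -> a <= n - a -> n - a < L ->
  admits_antimagic_orientation (comb n L [:: a]).
Proof.
move=> a0 aL a_le naL; apply: (iso_admits (comb_reroot_iso aL naL a_le)).
have [->|a1] := eqVneq a 1.
  by apply: comb_caterpillar => [|r]; rewrite ?inE; lia.
by apply: comb_long_arms => [||r] //=; rewrite ?inE; lia.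
Qed.

Lemma exists_min_max (R : seq nat) : 0 < size R ->
  exists a b, [/\ a \in R, b \in R & forall r, r \in R -> a <= r <= b].
Proof.
elim: R => // r [|r' R] IH _.
  by exists r, r; split=> [||u]; rewrite ?inE // => /eqP->; rewrite leqnn.
have [a [b [aR bR bd]]] := IH isT; exists (minn r a), (maxn r b); split.
- by case: (leqP r a) => _; rewrite inE ?eqxx ?aR ?orbT.
- by case: (leqP r b) => _; rewrite inE ?eqxx ?bR ?orbT.
- by move=> u; rewrite inE => /predU1P[->|/bd]; lia.
Qed.

(** Apart from degenerate cases, either both arms are at least as long as the legs, or a reversal,
    if needed, makes the right arm the short one. *)
Lemma comb_antimagic n L R : 0 < L -> 1 < n -> all (fun r => 0 < r < n) R ->
  admits_antimagic_orientation (comb n L R).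
Proof.
move=> L0 n1 /allP R_bd.
have [R0|R_gt0] := posnP (size R).
  rewrite (size0nil R0); apply: (iso_admits (comb_no_leg_iso n L)).
  exact: comb_caterpillar.
have [->|L1] := eqVneq L 1; first exact: comb_caterpillar.
have {L0 L1} L1 : 1 < L by lia.
have R_le : all (fun r => r <= n) R by apply/allP => r /R_bd /andP[_ /ltnW].
have [a [b [aR bR R_ab]]] := exists_min_max R_gt0.
have a_bd := R_bd a aR; have b_bd := R_bd b bR; have ab := R_ab b bR.
have [bL|bL] := ltnP (n - b) L.
  have [ok|] := boolP [|| L <= a, a < b | 1 < size R].
    by apply: comb_short_right L1 aR bR R_ab _ _ bL ok; lia.
  rewrite !negb_or -!ltnNge => /and3P[aL ba sz1].
  (* What is left is a single leg longer than both arms; the shorter arm becomes the leg, after a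
     reversal if it is the right one. *)
  have RE : R = [:: a].
    move: aR sz1 R_gt0; case: (R) => [|r [|]] //=; by rewrite inE => /eqP->.
  have [a_le|a_gt] := leqP a (n - a).
    by rewrite RE; apply: comb_three_legs; lia.
  rewrite RE in R_le *; apply: (iso_admits (comb_rev_iso L R_le)).
  by apply: comb_three_legs; lia.
have [La|aL] := leqP L a.
  by apply: comb_long_arms => // r /R_ab; lia.
apply: (iso_admits (comb_rev_iso L R_le)).
apply: (@comb_short_right n L _ (n - b) (n - a) L1).
- exact: map_f.
- exact: map_f.
- by move=> r /mapP[u /R_ab u_bd ->]; lia.
- lia.
- lia.
- lia.
- by rewrite bL.
Qed.

Theorem theorem2 (T : sgraph) (hT : is_subdivided_caterpillar T) :
  admits_antimagic_orientation T.
Proof.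
have [G [P [k [r [G_cat P_spine k_legs T_iso]]]]] := hT.
have [x0 _] : exists x0 : G, true.
  by have [_ G3 _] := G_cat; have /card_gt0P[x0 _] : 0 < #|G| := ltnW (ltnW G3); exists x0.
have [n [L [R [L0 n1 R_bd sd_iso]]]] := subdivided_caterpillar_comb x0 G_cat P_spine k_legs.
exact: iso_admits (iso_trans T_iso sd_iso) (comb_antimagic L0 n1 R_bd).
Qed.
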